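(* A linking $\lambda$ on a MALL sequent $\Gamma$ is a conflict net (that is, a slicing with $\{\lambda\}\leadsto^*\emptyset$) if and only if it is sequentializable, i.e. (up to isomorphism of links) the translation of some cut-free MALL proof of $\Gamma$.
   Context: Fix literals with an involution $a\mapsto\bar a$ ($\bar a\neq a$, $\bar{\bar a}=a$). MALL formulas are built from literals by $\otimes,⅋,\&,\oplus$; a sequent is a finite list of formulas, identified with the disjoint union of the parse trees of its formulas (leaves labelled by literals, internal vertices by connectives, edges directed towards roots). A root is a vertex with no outgoing edge. Two leaves are dual if their literals are dual. MALL proofs use: axiom $\vdash P,\bar P$; permutation (from $A_1..A_n$ infer $A_{\sigma1}..A_{\sigma n}$); $⅋$ (from $\Gamma,A,B$ infer $\Gamma,A⅋B$); $\oplus_i$ (from $\Gamma,A_i$ infer $\Gamma,A_0\oplus A_1$); $\otimes$ (from $\Gamma,A$ and $B,\Delta$ infer $\Gamma,A\otimes B,\Delta$); $\&$ (from $\Gamma,A$ and $\Gamma,B$ infer $\Gamma,A\&B$). Each rule induces inclusions of the premises' leaves into the conclusion's leaves (for $\&$ the leaves of $\Gamma$ in both premises go to the same leaves). A coherence space $X$ is a set $|X|$ of tokens with a symmetric irreflexive relation $\frown$; for distinct tokens, $x\#y$ iff not $x\frown y$. A map $X\to Y$ is a relation $R\subseteq|X|\times|Y|$ such that whenever $x_1Ry_1,x_2Ry_2$: $x_1\frown x_2\Rightarrow y_1\frown y_2$, and $y_1\#y_2\Rightarrow x_1\#x_2$. $X$ is contractible if $|X|$ is finite and $(|X|,\#)$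 has no induced 4-vertex path. $\mathrm{coh}(\Gamma)$ has the leaves of $\Gamma$ as tokens, with $x\#y$ iff $x\ne y$, both lie in one formula and the smallest subformula containing both has main connective $\&$ or $\oplus$. A linking on $\Gamma$ is a relation $\lambda\subseteq|L|\times\mathrm{leaves}(\Gamma)$, $L$ a finite coherence space whose tokens are links, such that each link is related to exactly two leaves, which are dual, and distinct links related to a common leaf are in conflict. A slicing is a linking with $L$ contractible and $\lambda$ a maximal (under inclusion) map $L\to\mathrm{coh}(\Gamma)$. Translation of a proof to a linking, by induction: an axiom gives one link related to both leaves; for permutation, $⅋$ and $\oplus_i$ the premise's $L,\lambda$ is kept, transported along the leaf inclusion; for $\otimes$ with premise linkings on $L$ and $M$, the result is $\lambda\cup\mu$ (transported) on $L\times M$, the disjoint union of the token sets with their relations and every token of $L$ strictly coherent with every token of $M$; for $\&$ the same on $L+M$, where every token of $L$ is in conflict with every token of $M$. For a slicing $\lambda$, let $\lambda^{\#}$ be the graph whose vertices are the vertices of $\Gamma$ and the links, with edges the parse-forest edges, $l$—$l'$ for $l\#l'$, and $l$—$x$ for $(l,x)\in\lambda$. $\lambda$ is connected if $|L|\ne\emptyset$ and $\lambda^{\#}$ is connected. A piece of $\lambda$ is its restriction to a connected component of $(|L|,\frown)$. For a root $r$ of $A_0\diamond A_1$ ($\diamond\in\{\&,\oplus\}$), a slicing touches $A_i$ if some leaf of $A_i$ is related to a link, chooses $A_i$ if it touches $A_i$ but not $A_{1-i}$, and $r$ is unary under it if it touches exactly one $A_i$. For a connected slicing $\lambda$ on $\Gamma$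 and a root $r$ of the formula $A_0\square A_1$ of $\Gamma$: $\square=\otimes$: ready if deleting $r$ from $\lambda^{\#}$ leaves two components; $\lambda\setminus r=\{\lambda_0,\lambda_1\}$, $\lambda_i$ the restriction to the links and formulas in the component containing $A_i$, on the sequent of those formulas in $\Gamma$'s order with $A_i$ in place of $A_0\otimes A_1$. $\square=⅋$: always ready; $\lambda\setminus r=\{\lambda_0\}$, same $L,\lambda$ on $\Gamma$ with $A_0,A_1$ in place of $A_0⅋A_1$. $\square=\oplus$: ready if $r$ is unary under $\lambda$, say $\lambda$ chooses $A_j$; $\lambda\setminus r$ is the same $L,\lambda$ on $\Gamma$ with $A_j$ in place of $A_0\oplus A_1$. $\square=\&$: ready if $r$ is unary under every piece; $\lambda\setminus r=\{\lambda_0,\lambda_1\}$ with $\lambda_i$ the union of pieces choosing $A_i$, on $\Gamma$ with $A_i$ in place of $A_0\&A_1$. A cluster is a set of slicings or the error symbol $\mathsf E$. Erasure: $Y\leadsto\mathsf E$ if $Y$ contains a disconnected slicing; $X\cup\{\lambda\}\leadsto X\cup(\lambda\setminus r)$ if $\lambda\notin X$, $\lambda$ connected, $r$ a ready root of $\lambda$, and all slicings of $X$ connected; $X\cup\{\lambda\}\leadsto X$ if $\lambda\notin X$, $\lambda$ is the single-link slicing on $P,\bar P$, and all slicings of $X$ connected. $\leadsto^*$ is the reflexive-transitive closure. *)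

(* Defs.v *)
From mathcomp Require Import all_boot.
From Stdlib Require Import Relation_Operators.
Set Implicit Arguments.
Unset Strict Implicit.
Unset Printing Implicit Defensive.

Inductive form (A : Type) : Type :=
| Lit of A
| Tens of form A & form A
| Par of form A & form A
| With of form A & form A
| Plus of form A & form A.
Arguments Lit {A} _.

(* A vertex of a sequent (a list of formulas, i.e. disjoint union of parse
   trees) is an address (i, p): formula number i (from 0) and path p from the
   root of that formula (false = left/0 subformula, true = right/1).        *)
Definition addr := (nat * seq bool)%type.

Fixpoint subf (A : Type) (f : form A) (p : seq bool) : option (form A) :=
  match p with
  | [::] => Some f
  | b :: q =>
    match f with
    | Lit _ => None
    | Tens f0 f1 | Par f0 f1 | With f0 f1 | Plus f0 f1 => subf (if b then f1 else f0) q
    end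
  end.

Definition subf_at (A : Type) (G : seq (form A)) (x : addr) : option (form A) :=
  if onth G x.1 is Some f then subf f x.2 else None.

Definition is_vertex (A : Type) (G : seq (form A)) (x : addr) : bool :=
  if subf_at G x is Some _ then true else false.

Definition lit_at (A : Type) (G : seq (form A)) (x : addr) : option A :=
  if subf_at G x is Some (Lit a) then Some a else None.

Definition is_leaf (A : Type) (G : seq (form A)) (x : addr) : bool :=
  if lit_at G x is Some _ then true else false.

Fixpoint lcp (p q : seq bool) : seq bool :=
  match p, q with
  | b :: p', c :: q' => if b == c then b :: lcp p' q' else [::]
  | _, _ => [::]
  end.

Definition is_additive (A : Type) (f : option (form A)) : bool :=
  match f with Some (With _ _) | Some (Plus _ _) => true | _ => false end.

Definition cohG_conf (A : Type) (G : seq (form A)) (x y : addr) : bool :=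
  [&& x != y, x.1 == y.1 & is_additive (subf_at G (x.1, lcp x.2 y.2))].

Definition cohG_coh (A : Type) (G : seq (form A)) (x y : addr) : bool :=
  (x != y) && ~~ cohG_conf G x y.

Definition conf (T : eqType) (coh : rel T) (x y : T) : bool :=
  (x != y) && ~~ coh x y.

Definition coh_space (T : finType) (coh : rel T) : Prop :=
  symmetric coh /\ irreflexive coh.

Section Proofs.
Variable A : eqType.
Variable bar : A -> A.

Inductive proof : seq (form A) -> Type :=
| pax (a : A) : proof [:: Lit a; Lit (bar a)]
| pperm (G : seq (form A)) (s : seq 'I_(size G)) :
    perm_eq s (enum 'I_(size G)) -> proof G ->
    proof (map (tnth (in_tuple G)) s)
| ppar (G : seq (form A)) (B C : form A) :
    proof (G ++ [:: B; C]) -> proof (G ++ [:: Par B C])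
| pplus (G : seq (form A)) (B0 B1 : form A) (i : bool) :
    proof (G ++ [:: if i then B1 else B0]) -> proof (G ++ [:: Plus B0 B1])
| ptens (G : seq (form A)) (B C : form A) (D : seq (form A)) :
    proof (G ++ [:: B]) -> proof (C :: D) -> proof (G ++ Tens B C :: D)
| pwith (G : seq (form A)) (B0 B1 : form A) :
    proof (G ++ [:: B0]) -> proof (G ++ [:: B1]) -> proof (G ++ [:: With B0 B1]).

Record lk := Lk { ltok : finType; lcoh : rel ltok; llam : ltok -> addr -> bool }.

(* Inverse of the leaf inclusions: address in the conclusion -> address in
   the premise (None if not coming from that premise). *)
Definition back_last (n : nat) (b : option bool) (x : addr) : option addr :=
  (* premise Gamma, B (size Gamma = n), conclusion Gamma, C with C having B as
     its b-subformula (or B itself when b = None, i.e. for no change). *)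
  if x.1 < n then Some x
  else if x.1 == n then
    match b, x.2 with
    | None, p => Some (n, p)
    | Some c, d :: p => if d == c then Some (n, p) else None
    | Some _, [::] => None
    end
  else None.

Definition optlam (l : lk) (t : ltok l) (o : option addr) : bool :=
  if o is Some y then llam t y else false.

Fixpoint tr (G : seq (form A)) (pi : proof G) {struct pi} : lk :=
  match pi with
  | pax a => @Lk unit (fun _ _ => false)
                 (fun _ x => (x == (0, [::])) || (x == (1, [::])))
  | pperm G s _ p =>
      let l := tr p in
      @Lk (ltok l) (@lcoh l)
          (fun t x => (x.1 < size s) && llam t (nth 0 (map val s) x.1, x.2))
  | ppar G B C p =>
      let l := tr p in
      let n := size G in
      @Lk (ltok l) (@lcoh l)
          (fun t x => if x.1 < n then llam t x
                      else if x.1 == n then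
                        match x.2 with
                        | false :: q => llam t (n, q)
                        | true :: q => llam t (n.+1, q)
                        | [::] => false end
                      else false)
  | pplus G B0 B1 i p =>
      let l := tr p in
      @Lk (ltok l) (@lcoh l) (fun t x => optlam t (back_last (size G) (Some i) x))
  | ptens G B C D p1 p2 =>
      let l1 := tr p1 in let l2 := tr p2 in
      let n := size G in
      @Lk (ltok l1 + ltok l2)%type
          (fun u v => match u, v with
                      | inl x, inl y => lcoh x y
                      | inr x, inr y => lcoh x y
                      | _, _ => true end)
          (fun u x => match u with
                      | inl t => optlam t (back_last n (Some false) x)
                      | inr t =>
                          if x.1 == n then
                            match x.2 with
                            | true :: q => llam t (0, q)
                            | _ => false end
                          else if n < x.1 then llam t (x.1 - n, x.2)
                          else false
                      end)
  | pwith G B0 B1 p1 p2 =>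
      let l1 := tr p1 in let l2 := tr p2 in
      let n := size G in
      @Lk (ltok l1 + ltok l2)%type
          (fun u v => match u, v with
                      | inl x, inl y => lcoh x y
                      | inr x, inr y => lcoh x y
                      | _, _ => false end)
          (fun u x => match u with
                      | inl t => optlam t (back_last n (Some false) x)
                      | inr t => optlam t (back_last n (Some true) x)
                      end)
  end.

Definition lk_iso (T : finType) (coh : rel T) (lam : T -> addr -> bool) (l : lk) : Prop :=
  exists f : T -> ltok l, bijective f /\
    (forall x y, lcoh (f x) (f y) = coh x y) /\
    (forall x a, llam (f x) a = lam x a).

Definition sequentializable (G : seq (form A)) (T : finType) (coh : rel T)
  (lam : T -> addr -> bool) : Prop :=
  exists pi : proof G, lk_iso coh lam (tr pi).

Definition dual_leaves (G : seq (form A)) (x y : addr) : Prop :=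
  exists a, lit_at G x = Some a /\ lit_at G y = Some (bar a).

Definition linking (G : seq (form A)) (T : finType) (coh : rel T)
  (lam : T -> addr -> bool) : Prop :=
  coh_space coh /\
  (forall t, exists x y, [/\ x != y, is_leaf G x, is_leaf G y &
                            [/\ lam t x, lam t y, dual_leaves G x y &
                                 forall z, lam t z -> z = x \/ z = y]]) /\
  (forall t t' x, t != t' -> lam t x -> lam t' x -> conf coh t t').

Definition is_map (G : seq (form A)) (T : finType) (coh : rel T)
  (R : T -> addr -> bool) : Prop :=
  (forall t x, R t x -> is_leaf G x) /\
  (forall x1 x2 y1 y2, R x1 y1 -> R x2 y2 ->
     (coh x1 x2 -> cohG_coh G y1 y2) /\
     (cohG_conf G y1 y2 -> conf coh x1 x2)).

Definition contractible (T : finType) (coh : rel T) : Prop :=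
  ~ exists a b c d : T,
      [/\ uniq [:: a; b; c; d],
          conf coh a b && conf coh b c && conf coh c d &
          ~~ conf coh a c && ~~ conf coh b d && ~~ conf coh a d].

Definition slicing (G : seq (form A)) (T : finType) (coh : rel T)
  (lam : T -> addr -> bool) : Prop :=
  linking G coh lam /\ contractible coh /\ is_map G coh lam /\
  (forall R, is_map G coh R -> (forall t x, lam t x -> R t x) ->
             forall t x, R t x -> lam t x).

(* Erasure.  All slicings arising by erasure from a slicing on tokens T are
   restrictions of it: a derived slicing is a sequent, a subset of the tokens
   of T (its links, with the restricted coherence), and a relation lambda. *)
Variable T : finType.
Variable coh : rel T.

Record slc := Slc { sG : seq (form A); sS : {set T}; sl : T -> addr -> bool }.

Definition slc_eq (s1 s2 : slc) : Prop :=
  sG s1 = sG s2 /\ sS s1 = sS s2 /\ forall t x, sl s1 t x = sl s2 t x.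

Definition vtx := (T + addr)%type.

Definition hvert (s : slc) (v : vtx) : bool :=
  match v with inl t => t \in sS s | inr x => is_vertex (sG s) x end.

Definition hedge (s : slc) (u v : vtx) : bool :=
  match u, v with
  | inr (i, p), inr (j, q) =>
      (i == j) && [|| q == rcons p false, q == rcons p true,
                      p == rcons q false | p == rcons q true]
  | inl t, inl t' => conf coh t t'
  | inl t, inr x => sl s t x
  | inr x, inl t => sl s t x
  end.

Definition hconn (s : slc) (P : vtx -> bool) (u v : vtx) : Prop :=
  clos_refl_trans vtx (fun x y => [&& P x, P y & hedge s x y]) u v.

Definition connected (s : slc) : Prop :=
  sS s != set0 /\
  forall u v, hvert s u -> hvert s v -> hconn s (hvert s) u v.

Definition two_components (s : slc) (P : vtx -> bool) : Prop :=
  exists u v, [/\ P u, P v, ~ hconn s P u v &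
                  forall w, P w -> hconn s P u w \/ hconn s P v w].

Definition root (i : nat) : vtx := inr (i, [::]).

Definition del_root (s : slc) (i : nat) : vtx -> bool :=
  fun v => hvert s v && (v != root i).

Definition tens_part (s : slc) (i : nat) (b : bool) (Ab : form A) (s' : slc) : Prop :=
  let C := hconn s (del_root s i) (inr (i, [:: b])) in
  exists sel : seq nat,
    [/\ sorted ltn sel,
        (forall j, j \in sel <-> (j < size (sG s) /\ (j = i \/ C (inr (j, [::]))))),
        sG s' = map (fun j => if j == i then Ab else nth Ab (sG s) j) sel,
        (forall t, t \in sS s' <-> (t \in sS s /\ C (inl t))) &
        (forall t k p, sl s' t (k, p) =
           [&& t \in sS s', k < size sel &
               (let j := nth 0 sel k in
                if j == i then sl s t (i, b :: p) else sl s t (j, p))])].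

Definition touches (s : slc) (i : nat) (b : bool) : Prop :=
  exists t p, [/\ t \in sS s, is_leaf (sG s) (i, b :: p) & sl s t (i, b :: p)].

Definition piece_conn (s : slc) (t t' : T) : Prop :=
  clos_refl_trans T (fun x y => [&& x \in sS s, y \in sS s & coh x y]) t t'.

Definition piece_touches (s : slc) (t : T) (i : nat) (b : bool) : Prop :=
  exists t' p, [/\ t' \in sS s, piece_conn s t t', is_leaf (sG s) (i, b :: p) &
                   sl s t' (i, b :: p)].

Definition piece_chooses (s : slc) (t : T) (i : nat) (b : bool) : Prop :=
  piece_touches s t i b /\ ~ piece_touches s t i (~~ b).

Definition with_part (s : slc) (i : nat) (b : bool) (Ab : form A) (s' : slc) : Prop :=
  [/\ sG s' = set_nth Ab (sG s) i Ab,
      (forall t, t \in sS s' <-> (t \in sS s /\ piece_chooses s t i b)) &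
      (forall t k p, sl s' t (k, p) =
         (t \in sS s') && (if k == i then sl s t (i, b :: p) else sl s t (k, p)))].

Definition par_res (s : slc) (i : nat) (B C : form A) : slc :=
  Slc (take i (sG s) ++ B :: C :: drop i.+1 (sG s)) (sS s)
      (fun t x =>
         if x.1 < i then sl s t x
         else if x.1 == i then sl s t (i, false :: x.2)
         else if x.1 == i.+1 then sl s t (i, true :: x.2)
         else sl s t (x.1.-1, x.2)).

Definition plus_res (s : slc) (i : nat) (j : bool) (Aj : form A) : slc :=
  Slc (set_nth Aj (sG s) i Aj) (sS s)
      (fun t x => if x.1 == i then sl s t (i, j :: x.2) else sl s t x).

(* ready_erase s R : s has a ready root r with lambda \ r = R (as a set of
   slicings, up to slc_eq). *)
Definition ready_erase (s : slc) (R : slc -> Prop) : Prop :=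
  (exists i B0 B1, [/\ onth (sG s) i = Some (Tens B0 B1),
      two_components s (del_root s i) &
      forall s', R s' <-> tens_part s i false B0 s' \/ tens_part s i true B1 s'])
  \/
  (exists i B0 B1, onth (sG s) i = Some (Par B0 B1) /\
      forall s', R s' <-> slc_eq s' (par_res s i B0 B1))
  \/
  (exists i B0 B1 (j : bool), [/\ onth (sG s) i = Some (Plus B0 B1),
      touches s i j, ~ touches s i (~~ j) &
      forall s', R s' <-> slc_eq s' (plus_res s i j (if j then B1 else B0))])
  \/
  (exists i B0 B1, [/\ onth (sG s) i = Some (With B0 B1),
      (forall t, t \in sS s -> piece_chooses s t i false \/ piece_chooses s t i true) &
      forall s', R s' <-> with_part s i false B0 s' \/ with_part s i true B1 s']).

Definition single_link (s : slc) : Prop :=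
  exists (a : A) (t : T),
    [/\ sG s = [:: Lit a; Lit (bar a)], sS s = [set t] &
        forall t' x, sl s t' x = (t' == t) && ((x == (0, [::])) || (x == (1, [::])))].

(* Clusters: Some X (a set of slicings, as a predicate, taken up to slc_eq)
   or None (the error symbol E). *)
Definition cluster := option (slc -> Prop).

Definition all_connected (X : slc -> Prop) : Prop := forall s, X s -> connected s.

Definition notin (X : slc -> Prop) (s : slc) : Prop := ~ exists s', X s' /\ slc_eq s' s.

Inductive estep : cluster -> cluster -> Prop :=
| es_err (Y : slc -> Prop) (s : slc) :
    Y s -> ~ connected s -> estep (Some Y) None
| es_erase (Y Y' X R : slc -> Prop) (s : slc) :
    (forall s', Y s' <-> X s' \/ slc_eq s' s) -> notin X s ->
    connected s -> ready_erase s R -> all_connected X ->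
    (forall s', Y' s' <-> X s' \/ R s') ->
    estep (Some Y) (Some Y')
| es_ax (Y X : slc -> Prop) (s : slc) :
    (forall s', Y s' <-> X s' \/ slc_eq s' s) -> notin X s ->
    single_link s -> all_connected X ->
    estep (Some Y) (Some X).

Definition esteps := clos_refl_trans cluster estep.

End Proofs.

Definition conflict_net (A : eqType) (bar : A -> A) (G : seq (form A))
  (T : finType) (coh : rel T) (lam : T -> addr -> bool) : Prop :=
  slicing bar G coh lam /\
  esteps bar coh (Some (fun s => slc_eq s (Slc G setT lam))) (Some (fun _ => False)).

(* Main.v *)
Require Import Defs.
From mathcomp Require Import all_boot.
From Stdlib Require Import Relation_Operators Operators_Properties ClassicalEpsilon.
From mathcomp Require Import zify.
Set Implicit Arguments.
Unset Strict Implicit.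
Unset Printing Implicit Defensive.

(** Soundness of erasure is read off backwards: each erasure step undoes one
    rule, so if all slicings of the next cluster come from proofs, so do those
    of the present one.  For a tensor root, connectedness forces the two
    components left by its deletion to be those of its two children, and links
    in different components cannot be in conflict; for a with root, links in
    different pieces are in conflict.

    Conversely, the translation of a proof is erased by undoing its last rule,
    the token sets of the slicings of a cluster staying disjoint so that no two
    of them merge.  Since exchange is not an erasure step, this is shown for
    copies of the translation with permuted formulas.  Maximality of the
    translation rests on the fact that every link is equal or coherent to some
    link touching any given formula of the sequent, which also shows that every
    piece of a with chooses a side. *)

(** An erasure step rewrites one member of a cluster, demands that all others be connected, and
    demands that the rewritten slicing not occur among them. Erasability is therefore proved
    relative to an arbitrary rest of the cluster. Disjointness of token sets is the condition on
    that rest which survives the steps: the parts of a slicing use subsets of its links, the two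
    parts of a binary step use disjoint ones, and nonempty disjoint token sets belong to different
    slicings.

    Most rules of the calculus act on the end of a sequent, whereas erasure acts at any root. In
    both directions a list [K] therefore separates the names of formula occurrences from their
    positions. The arithmetic of addresses is mostly confined to the inclusions [h], [c] of a
    premise into a conclusion; the arguments on maximality and connectedness use only that such an
    inclusion preserves subformulas and conflict. *)

(** * Translations of proofs are slicings *)

(* Formula number [k] of a premise is the subformula of the conclusion at [(h k, c k)]. *)
Definition place (h : nat -> nat) (c : nat -> seq bool) (x : addr) : addr :=
  (h x.1, c x.1 ++ x.2).

Lemma lcp_cat r p q : lcp (r ++ p) (r ++ q) = r ++ lcp p q.
Proof. by elim: r => //= b r ->; rewrite eqxx. Qed.

Section Addresses.
Variable A : eqType.
Implicit Types (G D : seq (form A)) (B C X : form A).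

Lemma subf_at_lt G x f : subf_at G x = Some f -> x.1 < size G.
Proof. by rewrite /subf_at -onthTE; case: (onth G x.1). Qed.

Lemma is_leaf_lt G x : is_leaf G x -> x.1 < size G.
Proof.
by rewrite /is_leaf /lit_at; case E: subf_at => [f|] // _; exact: subf_at_lt E.
Qed.

Lemma is_leaf_subf G G' x x' :
  subf_at G x = subf_at G' x' -> is_leaf G x = is_leaf G' x'.
Proof. by rewrite /is_leaf /lit_at => ->. Qed.

(** Different premise formulas may land in one conclusion formula, as the two components of a [Par]
    do. Hence the second clause asks for distinct images without conflict, not for different
    formulas. *)
Definition emb h c (G' G : seq (form A)) : Prop :=
  (forall k p, k < size G' -> subf_at G (place h c (k, p)) = subf_at G' (k, p)) /\
  (forall x y : addr, x.1 < size G' -> y.1 < size G' -> x.1 != y.1 ->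
     place h c x != place h c y /\
     cohG_conf G (place h c x) (place h c y) = false).

Lemma emb_inj h c G' G x y : emb h c G' G -> x.1 < size G' -> y.1 < size G' ->
  place h c x = place h c y -> x = y.
Proof.
move=> [_ E2] lx ly E; have [e|ne] := eqVneq x.1 y.1; last first.
  by have [] := E2 x y lx ly ne; rewrite E eqxx.
case: x y e E {lx ly} => k p [k' q] /= -> [] /eqP.
by rewrite eqseq_cat // eqxx /= => /eqP ->.
Qed.

(** Within one formula the common prefix [c] only shifts the vertex where two leaves meet, and the
    subformula there is kept. Across formulas both sides are false. *)
Lemma emb_conf h c G' G x y : emb h c G' G -> x.1 < size G' -> y.1 < size G' ->
  cohG_conf G (place h c x) (place h c y) = cohG_conf G' x y.
Proof.
move=> E lx ly; have [e|ne] := eqVneq x.1 y.1; last first.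
  by rewrite (E.2 x y lx ly ne).2 /cohG_conf (negbTE ne) andbF.
rewrite /cohG_conf /= e eqxx.
have -> : (place h c x != place h c y) = (x != y).
  by congr negb; apply/eqP/eqP => [|-> //]; exact: emb_inj E lx ly.
by rewrite !eqxx lcp_cat (E.1 y.1 (lcp x.2 y.2)) ?e.
Qed.

(** * Leaf inclusions of the rules *)

Definition par_h (n k : nat) : nat := minn k n.
(** Through [minn] the last two formulas, numbers [n] and [n.+1], share the number [n] of the [Par];
    the prefix tells them apart. *)
Definition par_c (n k : nat) := if k == n then [:: false] else if k == n.+1 then [:: true] else [::].
Definition last_c (n : nat) (b : bool) (k : nat) := if k == n then [:: b] else [::].
Definition tens_h (n k : nat) := n + k.
Definition tens_c (k : nat) := if k == 0 then [:: true] else [::].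

Lemma emb_perm G Q (d : form A) : perm_eq Q (iota 0 (size G)) ->
  emb (index^~ Q) (fun=> [::]) G (map (nth d G) Q).
Proof.
move=> pQ; have mQ k : (k \in Q) = (k < size G) by rewrite (perm_mem pQ) mem_iota.
split=> [k p lk|[k p] [k' p'] /= lk lk' ne].
  rewrite /subf_at /= onthE -map_comp (nth_map 0) ?index_mem ?mQ // nth_index ?mQ //=.
  by rewrite onthE (nth_map d).
have nei : index k Q != index k' Q.
  by apply: contra ne => /eqP e; apply/eqP; apply: (index_inj 0 _ _ e); rewrite mQ.
by rewrite /place /= /cohG_conf /= (negbTE nei) andbF xpair_eqE (negbTE nei).
Qed.

Lemma emb_par G B C : emb (par_h (size G)) (par_c (size G)) (G ++ [:: B; C]) (G ++ [:: Par B C]).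
Proof.
set n := size G; have eS : (n.+1 == n) = false by apply/negbTE; lia.
split=> [k p|[k p] [k' q]]; rewrite size_cat /= -/n.
  rewrite /place /subf_at /= !onth_cat -/n /par_h /par_c => lk.
  have [l|l] := ltnP k n.
    by rewrite l (ltn_eqF l) (ltn_eqF (ltn_trans l (ltnSn n))).
  rewrite ltnn subnn /=.
  have [->|ne] := eqVneq k n; first by rewrite subnn.
  by have -> : k = n.+1 by [lia]; rewrite eqxx subSnn.
move=> lk lk' ne; rewrite /place /cohG_conf /par_h /par_c /=.
have [e|nem] := eqVneq (minn k n) (minn k' n); last first.
  by rewrite andbF xpair_eqE (negbTE nem).
have [[-> ->]|[-> ->]] : (k = n /\ k' = n.+1) \/ (k = n.+1 /\ k' = n) by lia.
  by rewrite eqxx eS eqxx /= xpair_eqE andbF /= /subf_at /= onth_cat -/n minnn ltnn subnn.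
by rewrite eqxx eS eqxx /= xpair_eqE andbF /= /subf_at /= onth_cat -/n (minn_idPr _) // ltnn subnn.
Qed.

Lemma emb_last G B X D b : (forall p, subf X (b :: p) = subf B p) ->
  emb id (last_c (size G) b) (G ++ [:: B]) (G ++ X :: D).
Proof.
set n := size G => HX; split=> [k p|[k p] [k' q]]; rewrite size_cat /= -/n addn1.
  rewrite /place /subf_at /= !onth_cat -/n /last_c => lk.
  have [l|l] := ltnP k n; first by rewrite (ltn_eqF l).
  by have -> : k = n by [lia]; rewrite eqxx subnn /= -HX.
by move=> lk lk' ne; rewrite /place /cohG_conf /= xpair_eqE (negbTE ne) andbF.
Qed.

Lemma emb_tens G B C D : emb (tens_h (size G)) tens_c (C :: D) (G ++ Tens B C :: D).
Proof.
set n := size G; split=> [k p|[k p] [k' q]] /= lk.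
  rewrite /place /subf_at /= !onth_cat -/n /tens_h /tens_c.
  by have -> : (n + k < n) = false by [lia]; rewrite addKn; case: k lk.
move=> lk' ne; rewrite /place /cohG_conf /tens_h /= xpair_eqE eqn_add2l (negbTE ne).
by rewrite andbF.
Qed.

(** The part of the conclusion's translation that stems from one premise. The map [r] is the
    identity for unary rules and an injection into a sum for binary ones; [car_img] says that the
    links in its image touch nothing outside the premise. *)
Record carries h c (G' G : seq (form A)) (l' l : lk) (r : ltok l' -> ltok l) : Prop := Carries {
  car_emb : emb h c G' G;
  car_coh : forall u v, lcoh (r u) (r v) = lcoh u v;
  car_inj : injective r;
  car_lam : forall u k p, k < size G' -> llam (r u) (place h c (k, p)) = llam u (k, p);
  car_img : forall u x, llam (r u) x -> exists k p, k < size G' /\ x = place h c (k, p)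
}.

(** The induction invariant. Maximality alone is not inductive: at an additive rule something must
    keep links away from the side their premise does not contain, and [good_touch] provides it. *)
Record good (G : seq (form A)) (l : lk) : Prop := Good {
  good_leaf : forall (u : ltok l) x, llam u x -> is_leaf G x;
  good_inh : exists u : ltok l, True;
  good_sym : symmetric (@lcoh l);
  good_irr : irreflexive (@lcoh l);
  good_touch : forall (u : ltok l) k, k < size G ->
    exists u' p, (u' = u \/ lcoh u u') /\ llam u' (k, p);
  good_contr : contractible (@lcoh l);
  good_map : is_map G (@lcoh l) (@llam l);
  good_max : forall R, is_map G (@lcoh l) R -> (forall u x, llam u x -> R u x) ->
    forall u x, R u x -> llam u x
}.

Lemma carries_conf h c G' G l' l (r : ltok l' -> ltok l) u v :
  carries h c G' G r -> conf (@lcoh l) (r u) (r v) = conf (@lcoh l') u v.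
Proof. by case=> _ ch ij _ _; rewrite /conf ch (inj_eq ij). Qed.

Lemma carries_leaf h c G' G l' l (r : ltok l' -> ltok l) u x :
  carries h c G' G r -> good G' l' -> llam (r u) x -> is_leaf G x.
Proof.
move=> cr g L; have [k [p [lk e]]] := car_img cr L; move: L; rewrite e (car_lam cr) //.
by move/(good_leaf g); rewrite -(is_leaf_subf ((car_emb cr).1 k p lk)).
Qed.

Lemma carries_map h c G' G l' l (r : ltok l' -> ltok l) u v x y :
  carries h c G' G r -> good G' l' -> llam (r u) x -> llam (r v) y ->
  (lcoh (r u) (r v) -> cohG_coh G x y) /\ (cohG_conf G x y -> conf (@lcoh l) (r u) (r v)).
Proof.
move=> cr g Lx Ly.
have [k [p [lk ex]]] := car_img cr Lx; have [k' [q [lk' ey]]] := car_img cr Ly.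
move: Lx Ly; rewrite ex ey !(car_lam cr) // => Lx Ly.
have [_ /(_ _ _ _ _ Lx Ly) [M1 M2]] := good_map g.
rewrite (carries_conf _ _ cr) (car_coh cr) /cohG_coh (emb_conf (car_emb cr)) //.
split=> // /M1; rewrite /cohG_coh => /andP[ne ->]; rewrite andbT.
by apply: contra ne => /eqP /(emb_inj (car_emb cr)) ->.
Qed.

Lemma carries_touch h c G' G l' l (r : ltok l' -> ltok l) u k :
  carries h c G' G r -> good G' l' -> k < size G' ->
  exists u' p, (u' = r u \/ lcoh (r u) u') /\ llam u' (h k, p).
Proof.
move=> cr g lk; have [u' [p [U L]]] := good_touch g u lk.
exists (r u'), (c k ++ p); split; last by rewrite -(car_lam cr) in L.
by case: U => [->|H]; [left|right; rewrite (car_coh cr)].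
Qed.

(** Restricted to the links and formulas of the premise, the extension [R] is a map there, so
    maximality of the premise bounds it. *)
Lemma carries_max h c G' G l' l (r : ltok l' -> ltok l) R u k p :
  carries h c G' G r -> good G' l' ->
  is_map G (@lcoh l) R -> (forall u x, llam u x -> R u x) ->
  k < size G' -> R (r u) (place h c (k, p)) -> llam (r u) (place h c (k, p)).
Proof.
move=> cr g [R1 R2] RL lk Ru; rewrite (car_lam cr) //.
pose R' u x := (x.1 < size G') && R (r u) (place h c x).
apply: (good_max g (R := R')); last by rewrite /R' lk.
- split=> [v [k' q] /andP[/= lk'] /R1|u1 u2 x y /andP[lx Rx] /andP[ly Ry]].
    by rewrite (is_leaf_subf ((car_emb cr).1 _ _ lk')).
  have [M1 M2] := R2 _ _ _ _ Rx Ry; move: M1 M2.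
  rewrite (carries_conf _ _ cr) (car_coh cr) /cohG_coh (emb_conf (car_emb cr)) //.
  by move=> M1 M2; split=> // /M1 /andP[ne ->]; rewrite andbT; apply: contra ne => /eqP ->.
- move=> v [k' q] L; have lk' := is_leaf_lt (good_leaf g L).
  by rewrite /R' /= lk' RL // (car_lam cr).
Qed.

(** Leaves on opposite sides of an additive root conflict, so a map forces their links to conflict
    too, whereas [u] and [u'] are equal or coherent. *)
Lemma touch_excludes G (l : lk) R (u : ltok l) k B C b p :
  onth G k = Some (With B C) \/ onth G k = Some (Plus B C) ->
  is_map G (@lcoh l) R -> (forall u x, llam u x -> R u x) -> irreflexive (@lcoh l) ->
  (exists u' q, (u' = u \/ lcoh u u') /\ llam u' (k, ~~ b :: q)) ->
  R u (k, b :: p) -> False.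
Proof.
move=> HG [_ R2] RL irr [u' [q [U L]]] Ru.
have [_] := R2 _ _ _ _ Ru (RL _ _ L); rewrite /cohG_conf /= !xpair_eqE !eqxx /= /subf_at /=.
rewrite eqseq_cons; have -> : (b == ~~ b) = false by case: b {L Ru}.
have -> /= : is_additive (if onth G k is Some f then subf f [::] else None).
  by case: HG => ->.
move=> /(_ isT); rewrite /conf; case: U => [->|->]; by rewrite ?eqxx ?andbF.
Qed.

(* The leaf [y] would be coherent with every leaf touched by the premise, so it
   could be added to one of its links, against maximality. *)
Lemma coherent_excludes h c G' G l' l (r : ltok l' -> ltok l) R v y :
  carries h c G' G r -> good G' l' ->
  is_map G (@lcoh l) R -> (forall u x, llam u x -> R u x) ->
  (forall m, lcoh v (r m) /\ lcoh (r m) v) ->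
  y.1 < size G' -> R v (place h c y) -> False.
Proof.
move=> cr g MR ext vr ly Ru; have [m _] := good_inh g.
have ok (m' : ltok l') x : llam m' x -> cohG_coh G' y x /\ cohG_coh G' x y.
  move=> L; have lx := is_leaf_lt (good_leaf g L).
  have Lx : R (r m') (place h c x).
    by apply: ext; case: x L lx => k p L lx; rewrite (car_lam cr).
  have [/(_ (vr m').1) H1 _] := MR.2 _ _ _ _ Ru Lx.
  have [/(_ (vr m').2) H2 _] := MR.2 _ _ _ _ Lx Ru.
  move: H1 H2; rewrite /cohG_coh !(emb_conf (car_emb cr)) //.
  move=> /andP[N1 ->] /andP[N2 ->]; rewrite !andbT.
  by split; [apply: contra N1|apply: contra N2] => /eqP ->.
pose R' (w : ltok l') x := llam w x || (w == m) && (x == y).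
have /ok : llam m y.
  apply: (good_max g (R := R')); last by rewrite /R' !eqxx orbT.
    split=> [w x /orP[/(good_leaf g) //|/andP[_ /eqP ->]]|w w' x x'].
      case: y ly Ru {R' ok} => k p lk /MR.1.
      by rewrite (is_leaf_subf ((car_emb cr).1 k p lk)).
    case/orP=> [Lx|/andP[/eqP -> /eqP ->]] /orP[Lx'|/andP[/eqP -> /eqP ->]].
    + exact: (good_map g).2.
    + have [_ H] := ok _ _ Lx; split=> //.
      by move: H; rewrite /cohG_coh => /andP[_ /negbTE ->].
    + have [H _] := ok _ _ Lx'; split=> //.
      by move: H; rewrite /cohG_coh => /andP[_ /negbTE ->].
    + by rewrite (good_irr g) /cohG_conf eqxx.
  by move=> w x L; rewrite /R' L.
by case; rewrite /cohG_coh eqxx.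
Qed.

(** The last hypothesis confines every extension of the translation to addresses coming from the
    premise, where [carries_max] applies. *)
Lemma good_unary h c G' G (l' : lk) lam :
  carries h c G' G (l' := l') (l := @Lk (ltok l') (@lcoh l') lam) id -> good G' l' ->
  (forall k, k < size G -> exists2 k', k' < size G' & h k' = k) ->
  (forall R u x, is_map G (@lcoh l') R -> (forall u x, lam u x -> R u x) -> R u x ->
     exists k p, k < size G' /\ x = place h c (k, p)) ->
  good G (@Lk (ltok l') (@lcoh l') lam).
Proof.
move=> cr g hs cov; have [L I S R T C M X] := g; split=> //=.
- by move=> u x; exact: carries_leaf cr g.
- by move=> u k /hs [k' lk' <-]; exact: (carries_touch u cr g lk').
- split=> [u x|u v x y]; first exact: (@carries_leaf _ _ _ _ _ _ _ u x cr g).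
  exact: (@carries_map _ _ _ _ _ _ _ u v x y cr g).
- move=> R' MR ext u x Ru; have [k [p [lk e]]] := cov _ _ _ MR ext Ru.
  by subst x; exact: (carries_max (l := @Lk (ltok l') (@lcoh l') lam) cr g MR ext lk Ru).
Qed.

Definition sum_coh (b : bool) (l1 l2 : lk) : rel (ltok l1 + ltok l2) :=
  fun u v => match u, v with
             | inl x, inl y => lcoh x y
             | inr x, inr y => lcoh x y
             | _, _ => b end.

(** The four-vertex path and its complement are both connected, so an induced path cannot meet both
    summands, whether these are fully coherent or fully in conflict. *)
Lemma sum_contr b l1 l2 : contractible (@lcoh l1) -> contractible (@lcoh l2) ->
  contractible (@sum_coh b l1 l2).
Proof.
move=> C1 C2 [x [y [z [w [U P N]]]]].
case: x y z w U P N => [x|x] [y|y] [z|z] [w|w] U P N;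
  try by move: P N; rewrite /conf /=; case: b => //=; rewrite ?andbF ?andbT.
- by case: C1; exists x, y, z, w.
- by case: C2; exists x, y, z, w.
Qed.

Lemma sum_sym b l1 l2 : symmetric (@lcoh l1) -> symmetric (@lcoh l2) ->
  symmetric (@sum_coh b l1 l2).
Proof. by move=> S1 S2 [u|u] [v|v] /=. Qed.

Lemma sum_irr b l1 l2 : irreflexive (@lcoh l1) -> irreflexive (@lcoh l2) ->
  irreflexive (@sum_coh b l1 l2).
Proof. by move=> S1 S2 [u|u] /=. Qed.

(** For maximality, an extension could only add a leaf of one premise to a link of the other. Such a
    link is coherent with all links of the leaf's own premise, so [coherent_excludes] applies. *)
Lemma good_tens h1 c1 h2 c2 G1 G2 G l1 l2 lam :
  carries h1 c1 G1 G (l' := l1) (l := Lk (@sum_coh true l1 l2) lam) inl ->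
  carries h2 c2 G2 G (l' := l2) (l := Lk (@sum_coh true l1 l2) lam) inr ->
  good G1 l1 -> good G2 l2 ->
  (forall x, is_leaf G x -> (exists2 y, y.1 < size G1 & x = place h1 c1 y) \/
                            (exists2 y, y.1 < size G2 & x = place h2 c2 y)) ->
  (forall k, k < size G -> (exists2 k', k' < size G1 & h1 k' = k) \/
                           (exists2 k', k' < size G2 & h2 k' = k)) ->
  (forall x y, x.1 < size G1 -> y.1 < size G2 ->
     cohG_coh G (place h1 c1 x) (place h2 c2 y) /\
     cohG_coh G (place h2 c2 y) (place h1 c1 x)) ->
  good G (Lk (@sum_coh true l1 l2) lam).
Proof.
move=> cr1 cr2 g1 g2 covL covK cross; split=> /=.
- by case=> u x; [exact: carries_leaf cr1 g1|exact: carries_leaf cr2 g2].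
- by have [u _] := good_inh g1; exists (inl u).
- exact: sum_sym (good_sym g1) (good_sym g2).
- exact: sum_irr (good_irr g1) (good_irr g2).
- move=> u k /covK [[k' lk' <-]|[k' lk' <-]].
    case: u => u; first exact: (carries_touch u cr1 g1 lk').
    (* Here [u] belongs to the other premise and is coherent with every link of this one, so any
       link touching formula [k'] will do. *)
    have [v _] := good_inh g1; have [v' [p [_ L]]] := good_touch g1 v lk'.
    exists (inl v'), (c1 k' ++ p); split; first by right.
    by rewrite -(car_lam cr1) in L.
  case: u => u; last exact: (carries_touch u cr2 g2 lk').
  have [v _] := good_inh g2; have [v' [p [_ L]]] := good_touch g2 v lk'.
  exists (inr v'), (c2 k' ++ p); split; first by right.
  by rewrite -(car_lam cr2) in L.
- exact: sum_contr (good_contr g1) (good_contr g2).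
- split=> [[u|u] x|]; first exact: (carries_leaf cr1 g1); first exact: (carries_leaf cr2 g2).
  case=> u [v|v] x y Lx Ly.
  + exact: (carries_map cr1 g1 Lx Ly).
  + have [k [p [lk ex]]] := car_img cr1 Lx; have [k' [q [lk' ey]]] := car_img cr2 Ly.
    have [H _] := cross (k, p) (k', q) lk lk'; rewrite ex ey; split=> //.
    by move: H; rewrite /cohG_coh => /andP[_ /negbTE ->].
  + have [k [p [lk ex]]] := car_img cr2 Lx; have [k' [q [lk' ey]]] := car_img cr1 Ly.
    have [_ H] := cross (k', q) (k, p) lk' lk; rewrite ex ey; split=> //.
    by move: H; rewrite /cohG_coh => /andP[_ /negbTE ->].
  + exact: (carries_map cr2 g2 Lx Ly).
- move=> R MR ext.
  case=> u x Ru; case: (covL x (MR.1 _ _ Ru)) => -[[k p] lk e]; rewrite e in Ru *.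
  + exact: (carries_max cr1 g1 MR ext lk Ru).
  + by case: (coherent_excludes cr2 g2 MR ext _ lk Ru).
  + by case: (coherent_excludes cr1 g1 MR ext _ lk Ru).
  + exact: (carries_max cr2 g2 MR ext lk Ru).
Qed.

Lemma good_with h1 c1 h2 c2 G1 G2 G l1 l2 lam :
  carries h1 c1 G1 G (l' := l1) (l := Lk (@sum_coh false l1 l2) lam) inl ->
  carries h2 c2 G2 G (l' := l2) (l := Lk (@sum_coh false l1 l2) lam) inr ->
  good G1 l1 -> good G2 l2 ->
  (forall k, k < size G -> (exists2 k', k' < size G1 & h1 k' = k) /\
                           (exists2 k', k' < size G2 & h2 k' = k)) ->
  (forall R u x, is_map G (@sum_coh false l1 l2) R -> (forall u x, lam u x -> R u x) ->
     R (inl u) x -> exists k p, k < size G1 /\ x = place h1 c1 (k, p)) ->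
  (forall R u x, is_map G (@sum_coh false l1 l2) R -> (forall u x, lam u x -> R u x) ->
     R (inr u) x -> exists k p, k < size G2 /\ x = place h2 c2 (k, p)) ->
  good G (Lk (@sum_coh false l1 l2) lam).
Proof.
move=> cr1 cr2 g1 g2 covK cov1 cov2; split=> /=.
- by case=> u x; [exact: carries_leaf cr1 g1|exact: carries_leaf cr2 g2].
- by have [u _] := good_inh g1; exists (inl u).
- exact: sum_sym (good_sym g1) (good_sym g2).
- exact: sum_irr (good_irr g1) (good_irr g2).
- move=> [u|u] k /covK [[k1 lk1 e1] [k2 lk2 e2]].
    by rewrite -e1; exact: (carries_touch u cr1 g1 lk1).
  by rewrite -e2; exact: (carries_touch u cr2 g2 lk2).
- exact: sum_contr (good_contr g1) (good_contr g2).
- split=> [[u|u] x|]; first exact: (carries_leaf cr1 g1); first exact: (carries_leaf cr2 g2).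
  case=> u [v|v] x y Lx Ly //.
  + exact: (carries_map cr1 g1 Lx Ly).
  + exact: (carries_map cr2 g2 Lx Ly).
- move=> R MR ext [u|u] x Ru.
    have [k [p [lk e]]] := cov1 _ _ _ MR ext Ru; rewrite e in Ru *.
    exact: (carries_max cr1 g1 MR ext lk Ru).
  have [k [p [lk e]]] := cov2 _ _ _ MR ext Ru; rewrite e in Ru *.
  exact: (carries_max cr2 g2 MR ext lk Ru).
Qed.

(** * The translation of each rule *)

Variable bar : A -> A.

Lemma good_ax (a : A) : good [:: Lit a; Lit (bar a)] (tr (pax bar a)).
Proof.
split=> //=; first by move=> _ x /orP[] /eqP ->.
- move=> [] [|[|//]] _; exists tt, [::]; rewrite ?eqxx ?orbT; split=> //; by left.
- by move=> [[] [[] [c [d [/=]]]]].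
- split=> [_ x /orP[] /eqP -> //|[] [] x y].
  by rewrite /cohG_conf; do 2 case/orP=> /eqP ->; rewrite ?eqxx.
- move=> R [R1 _] ext [] x /R1; rewrite /is_leaf /lit_at /subf_at.
  by case: x => [[|[|k]] [|b p]] //=; rewrite onth0n.
Qed.

Lemma tnth_map_nth G (s : seq 'I_(size G)) d :
  map (tnth (in_tuple G)) s = map (nth d G) (map val s).
Proof. by rewrite -map_comp; apply: eq_map => i /=; rewrite (tnth_nth d). Qed.

Lemma perm_val n (s : seq 'I_n) : perm_eq s (enum 'I_n) -> perm_eq (map val s) (iota 0 n).
Proof. by move=> p; rewrite -val_enum_ord; exact: perm_map. Qed.

(** Supplies a default formula for [nth] in the exchange case. *)
Lemma proof_size G : proof bar G -> 0 < size G.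
Proof.
elim=> {G} [//|G s ps _ lG|G B C _ _|G B0 B1 i _ _|G B C D _ _ _ _|G B0 B1 _ _ _ _];
  rewrite ?size_cat /= ?addn1 ?addnS //.
by rewrite size_map (perm_size ps) size_enum_ord.
Qed.

Lemma good_perm G (s : seq 'I_(size G)) (ps : perm_eq s (enum 'I_(size G))) (pi : proof bar G) :
  good G (tr pi) -> good (map (tnth (in_tuple G)) s) (tr (pperm ps pi)).
Proof.
case: G s ps pi => [|d G0] s ps pi.
  by have := proof_size pi.
set G := d :: G0 => g; have pQ := perm_val ps; rewrite [tr _]/= (tnth_map_nth s d).
have zQ : size (map val s) = size G by rewrite (perm_size pQ) size_iota.
have mQ k : (k \in map val s) = (k < size G) by rewrite (perm_mem pQ) mem_iota.
have uQ : uniq (map val s) by rewrite (perm_uniq pQ) iota_uniq.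
have eh k p : k < size s -> (k, p) = place (index^~ (map val s)) (fun=> [::]) (nth 0 (map val s) k, p).
  by move=> lk; rewrite /place /= index_uniq // size_map.
apply: (@good_unary (index^~ (map val s)) (fun=> [::]) G).
- split=> //=; first exact: emb_perm.
    move=> u k p lk; rewrite nth_index ?mQ //=.
    by rewrite -(size_map val) index_mem mQ lk.
  move=> u [k p] /= /andP[lk L]; exists (nth 0 (map val s) k), p; split; last exact: eh.
  by rewrite -mQ mem_nth // size_map.
- exact: g.
- move=> k; rewrite size_map => lk; exists (nth 0 (map val s) k); first by rewrite -mQ mem_nth.
  by rewrite index_uniq.
- move=> R u [k p] [R1 _] _ /R1 /is_leaf_lt /=; rewrite !size_map => lk.
  exists (nth 0 (map val s) k), p; split; last exact: eh.
  by rewrite -mQ mem_nth // size_map.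
Qed.

Lemma par_img n m (x : addr) : x.1 < n \/ x.1 = n /\ x.2 <> [::] -> n.+2 <= m ->
  exists k p, k < m /\ x = place (par_h n) (par_c n) (k, p).
Proof.
have eS : (n.+1 == n) = false by apply/negbTE; lia.
case: x => k p /= [lk lm|[-> + lm]].
  exists k, p; split; first lia.
  by rewrite /place /par_h /par_c /= (minn_idPl (ltnW lk)) (ltn_eqF lk)
             (ltn_eqF (ltn_trans lk (ltnSn n))).
case: p => // -[] p _; last by exists n, p; split; [lia|rewrite /place /par_h /par_c /= minnn eqxx].
by exists n.+1, p; split; [lia|rewrite /place /par_h /par_c /= (minn_idPr _) // eS eqxx].
Qed.

Lemma carries_par G B C (pi : proof bar (G ++ [:: B; C])) :
  carries (par_h (size G)) (par_c (size G)) (G ++ [:: B; C]) (G ++ [:: Par B C])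
    (l' := tr pi) (l := tr (ppar pi)) id.
Proof.
rewrite [tr (ppar _)]/=; move: (tr pi) => l; set n := size G.
split=> //=; first exact: emb_par.
  rewrite size_cat /= => u k p lk; rewrite /place /par_h /par_c /= -/n.
  have [ltk|gek] := ltnP k n.
    by rewrite ltk (ltn_eqF ltk) (ltn_eqF (ltn_trans ltk (ltnSn n))).
  rewrite ltnn eqxx; have [->//|ne] := eqVneq k n.
  by have -> : k = n.+1 by [lia]; rewrite eqxx.
move=> u [k p] L; apply: par_img; last by rewrite size_cat addn2.
move: L => /=; rewrite -/n; case: ltngtP => // [|->]; first by left.
by case: p => // b p _; right.
Qed.

Lemma good_par G B C (pi : proof bar (G ++ [:: B; C])) :
  good (G ++ [:: B; C]) (tr pi) -> good (G ++ [:: Par B C]) (tr (ppar pi)).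
Proof.
move=> g; have cr := carries_par pi.
apply: (good_unary cr g).
  move=> k; rewrite !size_cat /= /par_h => lk; exists k; lia.
move=> R u [k p] [R1 _] _ /R1 L; apply: par_img; last by rewrite size_cat addn2.
move: (is_leaf_lt L); rewrite size_cat /= addn1 ltnS leq_eqVlt => /orP[/eqP e|]; last by left.
right; split=> // pe; move: L.
by rewrite e pe /is_leaf /lit_at /subf_at /= onth_cat ltnn subnn.
Qed.

Lemma last_img n b (x : addr) : x.1 < n \/ (x.1 = n /\ exists p, x.2 = b :: p) ->
  exists k p, k < n + 1 /\ x = place id (last_c n b) (k, p).
Proof.
case: x => k p /= [lk|[-> [q ->]]]; [exists k, p|exists n, q]; split; try lia.
  by rewrite /place /last_c /= (ltn_eqF lk).
by rewrite /place /last_c /= eqxx.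
Qed.

Lemma back_last_img n b x y : back_last n (Some b) x = Some y ->
  x.1 < n \/ (x.1 = n /\ exists p, x.2 = b :: p).
Proof.
case: x => k p; rewrite /back_last /=; case: ltnP => [|_]; first by left.
case: eqP => // ->; case: p => // d p; case: eqP => // -> _; right; split=> //; by exists p.
Qed.

Lemma back_last_place n b k p : k < n + 1 ->
  back_last n (Some b) (place id (last_c n b) (k, p)) = Some (k, p).
Proof.
rewrite addn1 ltnS leq_eqVlt => /orP[/eqP ->|lk]; rewrite /back_last /place /last_c /=.
  by rewrite ltnn !eqxx /= eqxx.
by rewrite lk (ltn_eqF lk).
Qed.

Lemma carries_last G B X D b (l' l : lk) (r : ltok l' -> ltok l) :
  (forall p, subf X (b :: p) = subf B p) ->
  (forall u v, lcoh (r u) (r v) = lcoh u v) -> injective r ->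
  (forall u x, llam (r u) x = optlam u (back_last (size G) (Some b) x)) ->
  carries id (last_c (size G) b) (G ++ [:: B]) (G ++ X :: D) r.
Proof.
move=> HX ch ij lm; split=> //.
- exact: emb_last.
- by move=> u k p; rewrite size_cat /= => lk; rewrite lm back_last_place.
- move=> u x; rewrite lm; case E: back_last => [y|] //= _.
  by rewrite size_cat; apply: last_img; exact: back_last_img E.
Qed.

(** The only leaves of the conclusion that are not in the premise lie on the other side of the
    additive root, and a link on side [b] equal or coherent to [u] excludes them. *)
Lemma additive_cover G B0 B1 X b (l : lk) R (u : ltok l) x :
  X = With B0 B1 \/ X = Plus B0 B1 ->
  is_map (G ++ [:: X]) (@lcoh l) R -> (forall u x, llam u x -> R u x) ->
  irreflexive (@lcoh l) ->
  (exists u' p, (u' = u \/ lcoh u u') /\ llam u' (size G, b :: p)) ->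
  R u x -> exists k p, k < size G + 1 /\ x = place id (last_c (size G) b) (k, p).
Proof.
move=> HX MR ext irr T Ru; apply: last_img; case: x Ru => k p Ru; have L := MR.1 _ _ Ru.
have := is_leaf_lt L; rewrite size_cat addn1 ltnS leq_eqVlt => /orP[/eqP /= e|]; last by left.
right; split=> //=; rewrite e in Ru L; case: p L Ru => [|d p] L Ru.
  move: L; rewrite /is_leaf /lit_at /subf_at /= onth_cat ltnn subnn /=.
  by case: HX => ->.
have [->|ne] := eqVneq d b; first by exists p.
have ed : b = ~~ d by case: b d ne {T L Ru} => [] [].
case: (@touch_excludes _ _ R u (size G) B0 B1 d p _ MR ext irr _ Ru); last by rewrite -ed.
by rewrite onth_cat ltnn subnn /=; case: HX => ->; [left|right].
Qed.

(** Used for maximality at the additive rules, and again in erasure to see that the right side of an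
    additive root is touched by the slicing or by each of its pieces. *)
Lemma touch_last G B X D b (l' l : lk) (r : ltok l' -> ltok l) u :
  carries id (last_c (size G) b) (G ++ [:: B]) (G ++ X :: D) r -> good (G ++ [:: B]) l' ->
  exists u' p, (u' = r u \/ lcoh (r u) u') /\ llam u' (size G, b :: p).
Proof.
move=> cr g; have lk : size G < size (G ++ [:: B]) by rewrite size_cat addn1.
have [u' [p [U L]]] := good_touch g u lk; exists (r u'), p; split.
  by case: U => [->|H]; [left|right; rewrite (car_coh cr)].
by rewrite -(car_lam cr) // /place /last_c eqxx in L.
Qed.

Lemma carries_plus G B0 B1 i (pi : proof bar (G ++ [:: if i then B1 else B0])) :
  carries id (last_c (size G) i) (G ++ [:: if i then B1 else B0])
    (G ++ [:: Plus B0 B1]) (l' := tr pi) (l := tr (pplus pi)) id.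
Proof. by apply: carries_last => //; case: i pi. Qed.

Lemma good_plus G B0 B1 i (pi : proof bar (G ++ [:: if i then B1 else B0])) :
  good (G ++ [:: if i then B1 else B0]) (tr pi) -> good (G ++ [:: Plus B0 B1]) (tr (pplus pi)).
Proof.
move=> g.
have cr := carries_plus pi.
apply: (@good_unary id (last_c (size G) i) _ _ _ _ cr g).
  by move=> k; rewrite !size_cat /= => lk; exists k.
move=> R u x MR ext Ru; rewrite size_cat.
apply: (@additive_cover _ B0 B1 _ i (tr (pplus pi)) R u x _ MR ext _ _ Ru); first by right.
  exact: good_irr g.
exact: (touch_last u cr g).
Qed.

Lemma carries_withl G B0 B1 (pi0 : proof bar (G ++ [:: B0])) (pi1 : proof bar (G ++ [:: B1])) :
  carries id (last_c (size G) false) (G ++ [:: B0])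
    (G ++ [:: With B0 B1]) (l' := tr pi0) (l := tr (pwith pi0 pi1)) inl.
Proof. by apply: carries_last => // u v []. Qed.

Lemma carries_withr G B0 B1 (pi0 : proof bar (G ++ [:: B0])) (pi1 : proof bar (G ++ [:: B1])) :
  carries id (last_c (size G) true) (G ++ [:: B1])
    (G ++ [:: With B0 B1]) (l' := tr pi1) (l := tr (pwith pi0 pi1)) inr.
Proof. by apply: carries_last => // u v []. Qed.

Lemma good_withp G B0 B1 (pi0 : proof bar (G ++ [:: B0])) (pi1 : proof bar (G ++ [:: B1])) :
  good (G ++ [:: B0]) (tr pi0) -> good (G ++ [:: B1]) (tr pi1) -> good (G ++ [:: With B0 B1]) (tr (pwith pi0 pi1)).
Proof.
move=> g0 g1.
have cr0 := carries_withl pi0 pi1; have cr1 := carries_withr pi0 pi1.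
have irr : irreflexive (@lcoh (tr (pwith pi0 pi1))).
  exact: (@sum_irr false) (good_irr g0) (good_irr g1).
apply: (good_with cr0 cr1 g0 g1).
- by move=> k; rewrite !size_cat /= => lk; split; exists k.
- move=> R u x MR ext Ru; rewrite size_cat.
  apply: (@additive_cover _ B0 B1 _ _ (tr (pwith pi0 pi1)) R (inl u) x _ MR ext irr _ Ru).
    by left.
  exact: (touch_last u cr0 g0).
- move=> R u x MR ext Ru; rewrite size_cat.
  apply: (@additive_cover _ B0 B1 _ _ (tr (pwith pi0 pi1)) R (inr u) x _ MR ext irr _ Ru).
    by left.
  exact: (touch_last u cr1 g1).
Qed.

Lemma carries_tensl G B C D (pi0 : proof bar (G ++ [:: B])) (pi1 : proof bar (C :: D)) :
  carries id (last_c (size G) false) (G ++ [:: B])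
    (G ++ Tens B C :: D) (l' := tr pi0) (l := tr (ptens pi0 pi1)) inl.
Proof. by apply: carries_last => // u v []. Qed.

(** Unlike [back_last], the translation back into the right premise does not bound the formula
    number from above; the bound in [car_img] comes from [good_leaf]. *)
Lemma carries_tensr G B C D (pi0 : proof bar (G ++ [:: B])) (pi1 : proof bar (C :: D)) :
  good (C :: D) (tr pi1) ->
  carries (tens_h (size G)) tens_c (C :: D)
    (G ++ Tens B C :: D) (l' := tr pi1) (l := tr (ptens pi0 pi1)) inr.
Proof.
move=> g1; set n := size G; split=> //=; first exact: emb_tens.
- by move=> u v [].
- move=> u k p lk; rewrite /tens_h /tens_c -/n; case: k lk => [|k] lk.
    by rewrite addn0 eqxx.
  rewrite -{2}[n]addn0 eqn_add2l addKn.
  by have -> : n < n + k.+1 by lia.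
- move=> u [k p] /=; rewrite -/n; case: eqP => [->|ne].
    case: p => // -[] // q _; exists 0, q; split=> //.
    by rewrite /place /tens_h /tens_c addn0.
  case: ltnP => // lk L; exists (k - n), p; split.
    exact: (is_leaf_lt (good_leaf g1 L)).
  rewrite /place /tens_h /tens_c /= subnKC; last lia.
  by have -> : (k - n == 0) = false by lia.
Qed.

Lemma good_tensp G B C D (pi0 : proof bar (G ++ [:: B])) (pi1 : proof bar (C :: D)) :
  good (G ++ [:: B]) (tr pi0) -> good (C :: D) (tr pi1) -> good (G ++ Tens B C :: D) (tr (ptens pi0 pi1)).
Proof.
move=> g0 g1; set n := size G.
have cr0 := carries_tensl pi0 pi1; have cr1 := carries_tensr pi0 g1.
apply: (good_tens cr0 cr1 g0 g1); rewrite ?size_cat /= ?addn1 //.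
- move=> [k p] L; have := is_leaf_lt L; rewrite size_cat /= => lk.
  have [ltk|gek] := ltnP k n.
    left; exists (k, p); first by rewrite /= -/n; lia.
    by rewrite /place /last_c /= (ltn_eqF ltk).
  have [e|ne] := eqVneq k n.
    case: p L => [|[] p] L.
    + by move: L; rewrite e /is_leaf /lit_at /subf_at /= onth_cat ltnn subnn.
    + by right; exists (0, p) => //; rewrite /place /tens_h /tens_c /= addn0 e.
    + by left; exists (n, p) => //; rewrite /place /last_c /= eqxx e.
  right; exists (k - n, p); first by rewrite /=; lia.
  rewrite /place /tens_h /tens_c /= subnKC //.
  by have -> : (k - n == 0) = false by lia.
- move=> k lk; have [ltk|gek] := ltnP k n; first by left; exists k => //; lia.
  by right; exists (k - n); rewrite /tens_h; lia.
- move=> [k p] [k' q] /= lk lk'.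
  have H : cohG_conf (G ++ Tens B C :: D) (place id (last_c n false) (k, p))
              (place (tens_h n) tens_c (k', q)) = false.
    rewrite /cohG_conf /place /last_c /tens_h /tens_c /= -/n.
    have [e|_] := eqVneq k (n + k'); last by rewrite andbF.
    have [-> ->] : k = n /\ k' = 0 by rewrite -/n in lk; lia.
    by rewrite eqxx /= /subf_at /= onth_cat ltnn subnn /= andbF.
  have H' : cohG_conf (G ++ Tens B C :: D) (place (tens_h n) tens_c (k', q))
              (place id (last_c n false) (k, p)) = false.
    rewrite /cohG_conf /place /last_c /tens_h /tens_c /= -/n.
    have [e|_] := eqVneq (n + k') k; last by rewrite andbF.
    have [-> ->] : k = n /\ k' = 0 by rewrite -/n in lk; lia.
    by rewrite !eqxx /= /subf_at /= onth_cat addn0 ltnn subnn /= ?andbF.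
  have N : place id (last_c n false) (k, p) != place (tens_h n) tens_c (k', q).
    rewrite /place /last_c /tens_h /tens_c /= xpair_eqE.
    have [e|//] := eqVneq k (n + k').
    have [-> ->] : k = n /\ k' = 0 by rewrite -/n in lk; lia.
    by rewrite !eqxx.
  by rewrite /cohG_coh H H' N eq_sym N.
Qed.

Lemma tr_good G (pi : proof bar G) : good G (tr pi).
Proof.
elim: pi => {G} [a|G s ps pi|G B C pi|G B0 B1 i pi|G B C D p0 g0 p1 g1|G B0 B1 p0 g0 p1 g1].
- exact: good_ax.
- exact: good_perm.
- exact: good_par.
- exact: good_plus.
- exact: good_tensp.
- exact: good_withp.
Qed.

End Addresses.

(** * Connectedness and erasability *)

Lemma onth_lt (U : Type) (d : U) (s : seq U) k : k < size s -> onth s k = Some (nth d s k).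
Proof. by move=> lk; rewrite onthE (nth_map d). Qed.

Lemma onth_set_nth (U : Type) (d b : U) (s : seq U) i k : i < size s ->
  onth (set_nth d s i b) k = if k == i then Some b else onth s k.
Proof.
move=> li; have zs : size (set_nth d s i b) = size s by rewrite size_set_nth; lia.
have [lk|lk] := ltnP k (size s).
  by rewrite !(onth_lt d) ?zs // nth_set_nth /=; case: eqP.
by rewrite !onth_default ?zs //; case: eqP => // e; lia.
Qed.

Lemma onth_insert2 (U : Type) (b c : U) (s : seq U) i k : i < size s ->
  onth (take i s ++ b :: c :: drop i.+1 s) k =
  if k < i then onth s k else if k == i then Some b else if k == i.+1 then Some c
  else onth s k.-1.
Proof.
move=> li; rewrite onth_cat size_take li.
have [lk|lk] := ltnP k i.
  by rewrite !(onth_lt b) ?size_take ?li ?nth_take //; lia.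
have [->|ne] := eqVneq k i; first by rewrite subnn.
have [->|ne'] := eqVneq k i.+1; first by rewrite subSnn.
have -> : k - i = (k - i.+2).+2 by lia.
rewrite /= !onthE map_drop nth_drop; congr nth; lia.
Qed.

Lemma subf0 (A : Type) (f : form A) : subf f [::] = Some f.
Proof. by case: f. Qed.

Lemma subf_cat (A : Type) (f : form A) p q :
  subf f (p ++ q) = if subf f p is Some f' then subf f' q else None.
Proof.
elim: p f => [f|b p IH [a|f0 f1|f0 f1|f0 f1|f0 f1]] //=.
by rewrite subf0.
Qed.

Section Graph.
Variables (A : eqType) (T : finType) (coh : rel T).
Hypothesis coh_sym : symmetric coh.
Implicit Types (s : slc A T) (P : vtx T -> bool) (u v w : vtx T).

Lemma conf_sym t t' : conf coh t t' = conf coh t' t.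
Proof. by rewrite /conf coh_sym eq_sym. Qed.

Lemma hedge_sym s u v : hedge coh s u v = hedge coh s v u.
Proof.
case: u v => [t|[i p]] [t'|[j q]] //=; first exact: conf_sym.
by rewrite eq_sym; congr andb; do 4 case: eqP => //=.
Qed.

Lemma hconn_refl s P u : hconn coh s P u u.
Proof. exact: rt_refl. Qed.

Lemma hconn_trans s P v u w : hconn coh s P u v -> hconn coh s P v w -> hconn coh s P u w.
Proof. exact: rt_trans. Qed.

Lemma hconn_edge s P u v : P u -> P v -> hedge coh s u v -> hconn coh s P u v.
Proof. by move=> Pu Pv E; apply: rt_step; rewrite Pu Pv. Qed.

Lemma hconn_sym s P u v : hconn coh s P u v -> hconn coh s P v u.
Proof.
elim=> {u v} [u v /and3P[Pu Pv E]|u|u v w _ H1 _ H2].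
- by apply: hconn_edge; rewrite // hedge_sym.
- exact: hconn_refl.
- exact: hconn_trans H2 H1.
Qed.

Lemma hconn_inv s P (Q : vtx T -> Prop) u v :
  (forall w w', Q w -> P w -> P w' -> hedge coh s w w' -> Q w') ->
  Q u -> hconn coh s P u v -> Q v.
Proof.
move=> inv Qu H; elim: H Qu => {u v} [u v /and3P[Pu Pv E] Qu|//|u v w _ H1 _ H2 /H1 /H2 //].
exact: inv E.
Qed.

Lemma vertex_rcons (G : seq (form A)) k p b : is_vertex G (k, rcons p b) -> is_vertex G (k, p).
Proof.
rewrite /is_vertex /subf_at /=; case: onth => // f; rewrite -cats1 subf_cat.
by case: subf.
Qed.

Lemma root_vertex (G : seq (form A)) k : is_vertex G (k, [::]) = (k < size G).
Proof. by rewrite /is_vertex /subf_at /= -onthTE; case: onth => // f; rewrite subf0. Qed.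

Lemma vertex_lt (G : seq (form A)) x : is_vertex G x -> x.1 < size G.
Proof. by rewrite /is_vertex; case E: subf_at => // _; exact: subf_at_lt E. Qed.

(** The path climbs the parse tree and stays at or below the ancestor. Only there is [P] required,
    so the root of the formula may be deleted when the ancestor is one of its children. *)
Lemma hconn_prefix s P k p q : is_vertex (sG s) (k, p ++ q) ->
  (forall r, is_vertex (sG s) (k, p ++ r) -> P (inr (k, p ++ r))) ->
  hconn coh s P (inr (k, p ++ q)) (inr (k, p)).
Proof.
move=> + HP; elim/last_ind: q => [|q b IH]; first by rewrite cats0 => _; exact: hconn_refl.
rewrite -rcons_cat => V; have V' := vertex_rcons V.
apply: (hconn_trans _ (IH V')); apply: hconn_edge.
- by rewrite rcons_cat; apply: HP; rewrite -rcons_cat.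
- exact: HP.
- by rewrite /= eqxx; case: b {V}; rewrite eqxx ?orbT.
Qed.

Lemma connected_intro s w : sS s != set0 ->
  (forall t, t \in sS s -> hconn coh s (hvert s) w (inl t)) ->
  (forall k, k < size (sG s) -> hconn coh s (hvert s) w (inr (k, [::]))) ->
  connected coh s.
Proof.
move=> S0 HT HR; split=> //.
suff H v : hvert s v -> hconn coh s (hvert s) w v.
  by move=> u v Hu Hv; apply: hconn_trans (H v Hv); apply: hconn_sym; exact: H.
case: v => [t|[k p]]; first exact: HT.
move=> V; apply: hconn_trans (HR k (vertex_lt V)) _; apply: hconn_sym.
by apply: (@hconn_prefix _ _ _ [::] p).
Qed.

Definition sub_slc h c s' s : Prop :=
  [/\ forall t, t \in sS s' -> t \in sS s,
      forall k p, k < size (sG s') ->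
        subf_at (sG s) (place h c (k, p)) = subf_at (sG s') (k, p) &
      forall t x, sl s' t x -> sl s t (place h c x)].

Definition vlift h c v : vtx T := if v is inr x then inr (place h c x) else v.

Lemma hvert_lift h c s' s v : sub_slc h c s' s -> hvert s' v -> hvert s (vlift h c v).
Proof.
case=> S1 S2 _; case: v => [t|[k p]]; first exact: S1.
move=> V; have lk := vertex_lt V.
by move: V; rewrite /= /is_vertex -S2.
Qed.

Lemma hedge_lift h c s' s u v : sub_slc h c s' s ->
  hedge coh s' u v -> hedge coh s (vlift h c u) (vlift h c v).
Proof.
case=> _ _ S3; case: u v => [t|[k p]] [t'|[k' q]] //=; try exact: (S3 _ (_, _)).
case/andP=> /eqP <-; rewrite eqxx /= !rcons_cat.
by case/or4P => /eqP ->; rewrite eqxx ?orbT.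
Qed.

(** The set [P] is left free so that lifted paths can be shown to avoid a deleted root. *)
Lemma hconn_lift h c s' s P u v : sub_slc h c s' s ->
  (forall w, hvert s' w -> P (vlift h c w)) ->
  hconn coh s' (hvert s') u v -> hconn coh s P (vlift h c u) (vlift h c v).
Proof.
move=> Sb HP; elim=> {u v} [u v /and3P[Pu Pv E]|u|u v w _ H1 _ H2].
- by apply: hconn_edge; [exact: HP|exact: HP|exact: hedge_lift E].
- exact: hconn_refl.
- exact: hconn_trans H1 H2.
Qed.

Lemma slc_eq_sym s s' : slc_eq s s' -> slc_eq s' s.
Proof. by case=> eG [eS H]; split=> //; split. Qed.

Lemma slc_eq_connected s s' : slc_eq s s' -> connected coh s -> connected coh s'.
Proof.
case=> eG [eS el] [S0 C]; split; first by rewrite -eS.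
have ev v : hvert s' v = hvert s v by case: v => [t|x] /=; rewrite ?eS ?eG.
move=> u v; rewrite !ev => Hu Hv; elim: (C u v Hu Hv) => {u v Hu Hv} [u v /and3P[Pu Pv E]|u|u v w _ H1 _ H2].
- apply: hconn_edge; rewrite ?ev //.
  by case: u v E {Pu Pv} => [t|[i p]] [t'|[j q]] //=; rewrite el.
- exact: hconn_refl.
- exact: hconn_trans H1 H2.
Qed.

(** * Erasability in a context *)

Variable bar : A -> A.

(** Here [X] is the rest of the cluster. A step only asks that [s] be absent from [X], but absence
    does not pass to the slicings produced from [s]; disjointness of tokens does. *)
Definition erasable s : Prop := forall X Y, all_connected coh X ->
  (forall s', X s' -> [disjoint sS s' & sS s]) ->
  (forall s', Y s' <-> X s' \/ slc_eq s' s) ->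
  esteps bar coh (Some Y) (Some X).

Lemma disjoint_notin (X : slc A T -> Prop) s : sS s != set0 ->
  (forall s', X s' -> [disjoint sS s' & sS s]) -> notin X s.
Proof.
move=> S0 dX [s' [Xs [_ [eS _]]]]; have := dX _ Xs.
by rewrite eS -setI_eq0 setIid (negbTE S0).
Qed.

Lemma erasable_ax s : single_link bar s -> erasable s.
Proof.
move=> sg X Y cX dX eY; apply: rt_step; apply: (es_ax eY _ sg cX).
apply: disjoint_notin dX; case: sg => a [t [_ -> _]].
by apply/set0Pn; exists t; rewrite inE.
Qed.

Lemma erasable_unary s s' : connected coh s -> sS s' = sS s ->
  ready_erase coh s (fun s1 => slc_eq s1 s') -> erasable s' -> erasable s.
Proof.
move=> cs eS re er X Y cX dX eY.
apply: (rt_trans _ _ _ (Some (fun s1 => X s1 \/ slc_eq s1 s'))).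
  apply: rt_step; apply: (es_erase _ eY) re cX _ => //.
  by apply: disjoint_notin dX; case: cs.
by apply: er; rewrite // eS.
Qed.

(** While [s0] is being erased, [s1] belongs to the context, so it has to be connected and disjoint
    from [s0]. Afterwards [s1] is erased in the original context. *)
Lemma erasable_binary s s0 s1 : connected coh s -> connected coh s1 ->
  sS s0 \subset sS s -> sS s1 \subset sS s -> [disjoint sS s0 & sS s1] ->
  ready_erase coh s (fun s' => slc_eq s' s0 \/ slc_eq s' s1) ->
  erasable s0 -> erasable s1 -> erasable s.
Proof.
move=> cs c1 b0 b1 d01 re e0 e1 X Y cX dX eY.
pose Y1 s' := X s' \/ slc_eq s' s1.
apply: (rt_trans _ _ _ (Some (fun s' => X s' \/ (slc_eq s' s0 \/ slc_eq s' s1)))).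
  apply: rt_step; apply: (es_erase _ eY) re cX _ => //.
  by apply: disjoint_notin dX; case: cs.
apply: (rt_trans _ _ _ (Some Y1)).
  apply: e0 => [s' [/cX //|/slc_eq_sym e]|s' [/dX|[_ [-> _]]]|s']; rewrite /Y1.
  - exact: slc_eq_connected e c1.
  - exact: disjointWr.
  - by rewrite disjoint_sym.
  - tauto.
by apply: e1 => // s' /dX; exact: disjointWr.
Qed.

End Graph.

(** * Translations of proofs are erasable *)

Section Matching.
Variables (A : eqType) (bar : A -> A) (T : finType) (coh : rel T).
Hypothesis coh_sym : symmetric coh.
Implicit Types (s : slc A T) (K : seq nat) (G D : seq (form A)).

(* [s] is a copy of [l], its formula number k being formula number K_k of G. *)
Record matches G (l : lk) K (g : ltok l -> T) s : Prop := Matches {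
  m_perm : perm_eq K (iota 0 (size G));
  m_size : size (sG s) = size K;
  m_onth : forall k, k < size K -> onth (sG s) k = onth G (nth 0 K k);
  m_inj : injective g;
  m_tok : forall t, t \in sS s <-> exists u, t = g u;
  m_coh : forall u v, coh (g u) (g v) = lcoh u v;
  m_lam : forall u k p, sl s (g u) (k, p) = (k < size K) && llam u (nth 0 K k, p);
  m_mask : forall t x, sl s t x -> t \in sS s
}.

Section MatchesTheory.
Variables (G : seq (form A)) (l : lk) (K : seq nat) (g : ltok l -> T) (s : slc A T).
Hypothesis M : matches G K g s.

Lemma m_sizeK : size K = size G.
Proof. by rewrite (perm_size (m_perm M)) size_iota. Qed.

Lemma m_mem k : (k \in K) = (k < size G).
Proof. by rewrite (perm_mem (m_perm M)) mem_iota. Qed.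

Lemma m_uniq : uniq K.
Proof. by rewrite (perm_uniq (m_perm M)) iota_uniq. Qed.

Lemma m_sl t k p : sl s t (k, p) -> t \in sS s /\ k < size K.
Proof.
move=> H; have St := m_mask M H; split=> //.
by move/(m_tok M): St => [u e]; move: H; rewrite e (m_lam M) => /andP[].
Qed.

Lemma m_subf k p : k < size K -> subf_at (sG s) (k, p) = subf_at G (nth 0 K k, p).
Proof. by move=> lk; rewrite /subf_at /= (m_onth M). Qed.

Lemma m_index n : n < size G -> index n K < size K.
Proof. by rewrite index_mem m_mem. Qed.

Lemma m_nth_index n : n < size G -> nth 0 K (index n K) = n.
Proof. by move=> ln; rewrite nth_index // m_mem. Qed.

Lemma m_nth_eq n k : n < size G -> k < size K -> (nth 0 K k == n) = (k == index n K).
Proof.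
move=> ln lk; rewrite -{1}(m_nth_index ln) nth_uniq ?m_uniq //.
exact: m_index.
Qed.

Lemma m_nth_lt k : k < size K -> nth 0 K k < size G.
Proof. by move=> lk; rewrite -m_mem mem_nth. Qed.

Lemma m_conf u v : conf coh (g u) (g v) = conf (@lcoh l) u v.
Proof. by rewrite /conf (m_coh M) (inj_eq (m_inj M)). Qed.

(** The maps [hs], [cs] place the formulas of the reduct [s'] in [s] by position, as [h], [c] place
    those of the premise in the conclusion by name; the second hypothesis on [K'] makes the two
    agree. *)
Lemma matches_premise h c G' (l' : lk) (r : ltok l' -> ltok l) hs cs K' s' :
  carries h c G' G r ->
  perm_eq K' (iota 0 (size G')) ->
  (forall k, k < size K' ->
     [/\ hs k < size K, nth 0 K (hs k) = h (nth 0 K' k) & cs k = c (nth 0 K' k)]) ->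
  size (sG s') = size K' ->
  (forall k, k < size K' -> onth (sG s') k = onth G' (nth 0 K' k)) ->
  (forall t, t \in sS s' <-> exists u, t = g (r u)) ->
  (forall t k p, sl s' t (k, p) =
     [&& t \in sS s', k < size K' & sl s t (place hs cs (k, p))]) ->
  matches G' K' (g \o r) s' /\ sub_slc hs cs s' s.
Proof.
move=> cr pK' hK zs os ts ls.
have zK' : size K' = size G' by rewrite (perm_size pK') size_iota.
have mK' k : k < size K' -> nth 0 K' k < size G'.
  by move=> lk; have := mem_nth 0 lk; rewrite (perm_mem pK') mem_iota.
split; split=> //.
- by move=> u v /(m_inj M) /(car_inj cr).
- by move=> u v; rewrite /= (m_coh M) (car_coh cr).
- move=> u k p /=; rewrite ls.
  have -> /= : g (r u) \in sS s' by apply/ts; exists u.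
  case: ltnP => //= lk; have [l1 e1 e2] := hK k lk.
  rewrite /place /= (m_lam M) l1 e1 e2 /=.
  exact: (car_lam cr u p (mK' k lk)).
- by move=> t [k p]; rewrite ls => /andP[].
- by move=> t /ts [u ->]; apply/(m_tok M); exists (r u).
- move=> k p; rewrite zs => lk; have [l1 e1 e2] := hK k lk.
  rewrite /place /= (m_subf _ l1) e1 e2 ((car_emb cr).1 _ _ (mK' k lk)).
  by rewrite /subf_at /= os.
- by move=> t [k p]; rewrite ls => /and3P[].
Qed.

End MatchesTheory.

(** The lifts of the two connected parts reach every link and every formula of [s], so a single path
    between them is enough. *)
Lemma connected_join h0 c0 s0 h1 c1 s1 s v0 v1 :
  sub_slc h0 c0 s0 s -> sub_slc h1 c1 s1 s -> connected coh s0 -> connected coh s1 ->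
  (forall t, t \in sS s -> t \in sS s0 \/ t \in sS s1) ->
  (forall k, k < size (sG s) -> (exists2 k', k' < size (sG s0) & h0 k' = k) \/
                                (exists2 k', k' < size (sG s1) & h1 k' = k)) ->
  hvert s0 v0 -> hvert s1 v1 ->
  hconn coh s (hvert s) (vlift h0 c0 v0) (vlift h1 c1 v1) ->
  connected coh s.
Proof.
move=> b0 b1 [S0 C0] [S1 C1] tc kc V0 V1 vv.
have L0 v : hvert s0 v -> hconn coh s (hvert s) (vlift h0 c0 v0) (vlift h0 c0 v).
  by move=> V; apply: (hconn_lift b0 _ (C0 _ _ V0 V)) => w; exact: hvert_lift.
have L1 v : hvert s1 v -> hconn coh s (hvert s) (vlift h0 c0 v0) (vlift h1 c1 v).
  move=> V; apply: (hconn_trans vv).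
  by apply: (hconn_lift b1 _ (C1 _ _ V1 V)) => w; exact: hvert_lift.
apply: (connected_intro coh_sym (w := vlift h0 c0 v0)).
- by case/set0Pn: S0 => t St; apply/set0Pn; exists t; case: b0 => + _ _; apply.
- by move=> t /tc [St|St]; [exact: (L0 (inl t))|exact: (L1 (inl t))].
- move=> k /kc [[k' lk' e]|[k' lk' e]].
    have V : hvert s0 (inr (k', [::])) by rewrite /= root_vertex.
    apply: (hconn_trans (L0 _ V)); have := hvert_lift b0 V.
    rewrite /= /place /= e -[c0 k' ++ [::]]cat0s => V'.
    by apply: (@hconn_prefix _ _ _ _ _ _ [::]).
  have V : hvert s1 (inr (k', [::])) by rewrite /= root_vertex.
  apply: (hconn_trans (L1 _ V)); have := hvert_lift b1 V.
  rewrite /= /place /= e -[c1 k' ++ [::]]cat0s => V'.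
  by apply: (@hconn_prefix _ _ _ _ _ _ [::]).
Qed.

(** A covering part is joined with itself. *)
Lemma connected_cover h c s' s : sub_slc h c s' s -> connected coh s' ->
  (forall t, t \in sS s -> t \in sS s') ->
  (forall k, k < size (sG s) -> exists2 k', k' < size (sG s') & h k' = k) ->
  connected coh s.
Proof.
move=> b C tc kc; have [t St] : exists t, t \in sS s' by case: C => /set0Pn.
apply: (connected_join b b C C (v0 := inl t) (v1 := inl t)) => //.
- by move=> t' /tc; left.
- by move=> k /kc; left.
- exact: hconn_refl.
Qed.

(** * Erasing the last rule of a proof *)

Definition erases (G : seq (form A)) (l : lk) : Prop :=
  forall K (g : ltok l -> T) s, matches G K g s -> connected coh s /\ erasable coh bar s.

Lemma erases_ax (bar_invol : involutive bar) a :
  erases [:: Lit a; Lit (bar a)] (tr (pax bar a)).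
Proof.
move=> K g s M.
have sS1 : sS s = [set g tt].
  apply/setP => t; rewrite inE; apply/idP/eqP => [/(m_tok M) [[] //]|->].
  by apply/(m_tok M); exists tt.
have KE : K = [:: 0; 1] \/ K = [:: 1; 0].
  have := m_uniq M; have := m_sizeK M; have : perm_eq K [:: 0; 1] := m_perm M.
  case: K {M} => [|x [|y []]] // /perm_mem E _.
  have := E x; have := E y; rewrite !inE !eqxx orbT /=.
  by move=> /esym /orP[] /eqP -> /esym /orP[] /eqP -> //; [right|left].
have slE t x : sl s t x = (t == g tt) && ((x == (0, [::])) || (x == (1, [::]))).
  case: x => k p; have [->|ne] /= := eqVneq t (g tt); last first.
    by apply/negP => /(m_mask M); rewrite sS1 inE (negbTE ne).
  rewrite (m_lam M) /=.
  by case: KE => ->; case: k => [|[|k]] //=; rewrite !xpair_eqE /= ?orbF.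
have sg : single_link bar s.
  have : sG s = [:: Lit a; Lit (bar a)] \/ sG s = [:: Lit (bar a); Lit a].
    have := m_size M; have := m_onth M.
    case: KE => ->; case: (sG s) => [|f0 [|f1 []]] // O _;
      have := O 0 isT; have := O 1 isT => /= -[->] [->]; by [left|right].
  (* The copy with its two leaves exchanged is the axiom on [bar a], since [bar] is an
     involution. *)
  by case=> eG; [exists a|exists (bar a)]; exists (g tt); rewrite ?bar_invol.
split; last exact: erasable_ax.
have V : hvert s (inl (g tt)) by rewrite /= sS1 inE.
apply: (connected_intro coh_sym (w := inl (g tt))).
- by apply/set0Pn; exists (g tt).
- by move=> t; rewrite sS1 inE => /eqP ->; exact: hconn_refl.
- move=> k lk; apply: hconn_edge => //; first by rewrite /= root_vertex.
  move: lk; rewrite (m_size M) (m_sizeK M) /= slE eqxx /=.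
  by case: k => [|[]].
Qed.

(** A copy of the conclusion is itself a copy of the premise, under the naming [K] composed with
    [Q]. Exchange thus costs no erasure step. *)
Lemma erases_perm G (q : seq 'I_(size G)) (pq : perm_eq q (enum 'I_(size G)))
    (pi : proof bar G) :
  erases G (tr pi) -> erases (map (tnth (in_tuple G)) q) (tr (pperm pq pi)).
Proof.
move=> IH K g s M; have pQ := perm_val pq; set Q := map val q in pQ.
have zQ : size Q = size G by rewrite (perm_size pQ) size_iota.
have zq : size q = size Q by rewrite size_map.
have zK : size K = size Q by rewrite (m_sizeK M) size_map.
have ltK k : k < size K -> nth 0 K k < size Q.
  by move=> lk; have := m_nth_lt M lk; rewrite size_map zq.
have d : form A by case: (G) (proof_size pi) => [|d].
apply: (IH (map (nth 0 Q) K) g s); split.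
- apply: perm_trans pQ; rewrite -{2}(mkseq_nth 0 Q) /mkseq; apply: perm_map.
  by have := m_perm M; rewrite size_map zq.
- by rewrite size_map (m_size M).
- move=> k; rewrite size_map => lk; rewrite (m_onth M lk) (nth_map 0) //.
  have lQ : nth 0 Q (nth 0 K k) < size G.
    by have := mem_nth 0 (ltK k lk); rewrite (perm_mem pQ) mem_iota.
  by rewrite (tnth_map_nth q d) onthE -map_comp (nth_map 0) ?ltK //= onthE (nth_map d).
- exact: m_inj M.
- exact: m_tok M.
- exact: m_coh M.
- move=> u k p; rewrite (m_lam M) size_map /=; case: ltnP => //= lk.
  by rewrite (nth_map 0) // zq ltK.
- exact: m_mask M.
Qed.

Lemma erases_par G B C (pi : proof bar (G ++ [:: B; C])) :
  erases (G ++ [:: B; C]) (tr pi) -> erases (G ++ [:: Par B C]) (tr (ppar pi)).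
Proof.
move=> IH K g s M; set n := size G; set i := index n K.
have ln : n < size (G ++ [:: Par B C]) by rewrite size_cat addn1.
have zK : size K = n.+1 by rewrite (m_sizeK M) size_cat addn1.
have li : i < size K := m_index M ln.
have ei : nth 0 K i = n := m_nth_index M ln.
have Klt k : k < size K -> k != i -> nth 0 K k < n.
  move=> lk; have := m_nth_lt M lk; rewrite size_cat addn1 ltnS leq_eqVlt.
  by rewrite (m_nth_eq M ln lk) -/i => /orP[->|].
(* The other entries of [K] are below [n], and they name the same formulas in premise and
   conclusion. *)
pose K' := take i K ++ n :: n.+1 :: drop i.+1 K.
have zK' : size K' = n.+2 by rewrite size_cat /= size_take size_drop li zK; lia.
have nK' k : nth 0 K' k = if k < i then nth 0 K k else if k == i then n
    else if k == i.+1 then n.+1 else nth 0 K k.-1.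
  by rewrite -!odflt_onth onth_insert2 //; do 3 case: ifP => // _.
(* Positions [i] and [i.+1] of the result both come from position [i] of [s]. *)
pose hs k := if k <= i then k else k.-1.
have [M' Sb] : matches (l := tr pi) (G ++ [:: B; C]) K' (g \o id) (par_res s i B C) /\
    sub_slc hs (par_c i) (par_res s i B C) s.
  apply: (@matches_premise _ _ _ _ _ M _ _ _ (tr pi) id hs (par_c i) K' _ (carries_par pi)); rewrite ?zK'.
  - have -> : iota 0 (size (G ++ [:: B; C])) = rcons (iota 0 n.+1) n.+1.
      by rewrite size_cat addn2 -/n -(addn1 n.+1) iotaD -cats1.
    apply: (perm_trans (y := n.+1 :: K)).
      have eK : take i K ++ n :: drop i.+1 K = K by rewrite -ei -drop_nth // cat_take_drop.
      rewrite -{1}eK /K' -(cat_rcons n _ (drop _ _)) -(cat_rcons n _ (_ :: _)).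
      rewrite -[n.+1 :: drop _ _]cat1s -[n.+1 :: _ ++ _]cat1s.
      by apply/permPl; exact: perm_catCA.
    rewrite perm_sym perm_rcons perm_cons perm_sym (perm_trans (m_perm M)) //.
    by rewrite size_cat addn1.
  - move=> k lk; rewrite nK' /hs /par_h /par_c; case: (ltngtP k i) => [lki|lki|eki].
    + have Kl := Klt k (ltn_trans lki li) (negbT (ltn_eqF lki)).
      rewrite (ltn_trans lki li) (ltn_eqF Kl) (ltn_eqF (ltn_trans Kl (ltnSn n))).
      by rewrite (ltn_eqF (ltn_trans lki (ltnSn i))) (minn_idPl (ltnW Kl)).
    + have [->|ne] := eqVneq k i.+1.
        rewrite /= li ei eqxx; have -> : (n.+1 == n) = false by apply/negbTE; lia.
        by rewrite (minn_idPr _).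
      have lk1 : k.-1 < size K by rewrite zK; lia.
      have Kl : nth 0 K k.-1 < n by apply: Klt => //; apply/eqP; lia.
      rewrite lk1 (ltn_eqF Kl) (ltn_eqF (ltn_trans Kl (ltnSn n))).
      by rewrite (minn_idPl (ltnW Kl)).
    + by rewrite eki li ei eqxx minnn.
  - by rewrite size_cat /= size_take size_drop (m_size M) li zK; lia.
  - move=> k lk; rewrite /= onth_insert2 ?(m_size M) // nK' !onth_cat -/n.
    have onK j : j < size K -> j != i -> onth (sG s) j = onth G (nth 0 K j).
      by move=> lj ne; rewrite (m_onth M lj) onth_cat Klt.
    case: (ltngtP k i) => [lki|lki|eki].
    + have lkK := ltn_trans lki li; have ne := negbT (ltn_eqF lki).
      by rewrite (Klt _ lkK ne) onK.
    + have [_|ne] := eqVneq k i.+1; first by rewrite ltnNge leqnSn subSnn.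
      have lk1 : k.-1 < size K by rewrite zK; lia.
      have nei : k.-1 != i by apply/eqP; lia.
      by rewrite (Klt _ lk1 nei) onK.
    + by rewrite ltnn subnn.
  - exact: m_tok M.
  - move=> t k p; rewrite /par_res /place /hs /par_c /=.
    have H x : sl s t x -> t \in sS s /\ x.1 < size K by case: x => k' p'; exact: (m_sl M).
    apply/idP/and3P => [L|[_ _]]; last first.
      case: (ltngtP k i) => [lki|lki|->].
      + by rewrite (ltn_eqF (ltn_trans lki (ltnSn i))).
      + by case: eqP => // ->.
      + by rewrite ?eqxx.
    move: L; case: (ltngtP k i) => [lki|lki|->].
    + by rewrite (ltn_eqF (ltn_trans lki (ltnSn i))) => L; have [St /=] := H _ L; rewrite zK; split=> //; lia.
    + case: eqP => [->|_] L; have [St /=] := H _ L; rewrite zK => lk; split=> //; lia.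
    + by rewrite ?eqxx => L; have [St /=] := H _ L; rewrite zK => lk; split=> //; lia.
have [C' E'] := IH _ _ _ M'.
have Cs : connected coh s.
  apply: (connected_cover Sb C') => // k; rewrite (m_size M) (m_size M') zK' zK /hs => lk.
  have [lki|lki] := leqP k i; first by exists k; [lia|rewrite lki].
  by exists k.+1; [lia|rewrite leqNgt ltnS ltnW].
split=> //; apply: (erasable_unary Cs (s' := par_res s i B C)) => //.
right; left; exists i, B, C; split=> //.
by rewrite (m_onth M li) ei onth_cat ltnn subnn.
Qed.

Lemma matches_last G B X b (l' l : lk) (r : ltok l' -> ltok l) K (g : ltok l -> T) s s' :
  let i := index (size G) K in
  matches (G ++ [:: X]) K g s ->
  carries id (last_c (size G) b) (G ++ [:: B]) (G ++ [:: X]) r ->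
  sG s' = set_nth B (sG s) i B ->
  (forall t, t \in sS s' <-> exists u, t = g (r u)) ->
  (forall t k p, sl s' t (k, p) =
     (t \in sS s') && (if k == i then sl s t (i, b :: p) else sl s t (k, p))) ->
  matches (G ++ [:: B]) K (g \o r) s' /\ sub_slc id (last_c i b) s' s.
Proof.
move=> i M cr eG ts ls; set n := size G.
have ln : n < size (G ++ [:: X]) by rewrite size_cat addn1.
have zGX : size (G ++ [:: B]) = size (G ++ [:: X]) by rewrite !size_cat.
have li : i < size K := m_index M ln.
have ei : nth 0 K i = n := m_nth_index M ln.
apply: (matches_premise M cr).
- by rewrite zGX; exact: m_perm M.
- by move=> k lk; split=> //; rewrite /last_c (m_nth_eq M ln lk).
- by rewrite eG size_set_nth (m_size M); lia.
- move=> k lk; rewrite eG onth_set_nth ?(m_size M) // -(m_nth_eq M ln lk) onth_cat -/n.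
  case: eqP => [->|ne]; first by rewrite ltnn subnn.
  have ltk : nth 0 K k < n by have := m_nth_lt M lk; rewrite size_cat addn1 -/n; lia.
  by rewrite ltk (m_onth M lk) onth_cat -/n ltk.
- exact: ts.
- move=> t k p; rewrite ls /place /last_c /=; case: (t \in sS s') => //=.
  case: eqP => [->|_]; first by rewrite li.
  by apply/idP/andP => [L|[]//]; split=> //; case: (m_sl M L).
Qed.

Lemma carries_last_side G B X D b (l' l : lk) (r : ltok l' -> ltok l) u d p :
  carries id (last_c (size G) b) (G ++ [:: B]) (G ++ X :: D) r ->
  llam (r u) (size G, d :: p) -> d = b.
Proof.
move=> cr L; have [k [q [_ [e]]]] := car_img cr L.
by rewrite /last_c -e eqxx => -[].
Qed.

Lemma erases_plus G B0 B1 j (pi : proof bar (G ++ [:: if j then B1 else B0])) :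
  erases (G ++ [:: if j then B1 else B0]) (tr pi) ->
  erases (G ++ [:: Plus B0 B1]) (tr (pplus pi)).
Proof.
move=> IH K g s M; set n := size G; set i := index n K.
have ln : n < size (G ++ [:: Plus B0 B1]) by rewrite size_cat addn1.
have li : i < size K := m_index M ln.
have ei : nth 0 K i = n := m_nth_index M ln.
have cr := carries_plus pi; set B := if j then B1 else B0.
have gd := tr_good (pplus pi); have gd' := tr_good pi.
have [M' Sb] : matches (l := tr pi) (G ++ [:: B]) K (g \o id) (plus_res s i j B) /\
    sub_slc id (last_c i j) (plus_res s i j B) s.
  apply: (@matches_last G B _ j (tr pi) (tr (pplus pi)) id K g s _ M cr).
  - by [].
  - exact: m_tok M.
  - move=> t k p /=; apply/idP/andP => [L|[] //]; split=> //.
    by move: L; case: eqP => _ /(m_sl M) [].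
have [C' E'] := IH _ _ _ M'.
have Cs : connected coh s.
  apply: (connected_cover Sb C') => // k; rewrite (m_size M) (m_size M') => lk; by exists k.
split=> //; apply: (erasable_unary Cs (s' := plus_res s i j B)) => //.
have [u _] := good_inh gd'.
have [u' [p [_ L]]] := touch_last u cr gd'.
right; right; left; exists i, B0, B1, j; split=> //.
- by rewrite (m_onth M li) ei onth_cat ltnn subnn.
- exists (g u'), p; split; first by apply/(m_tok M); exists u'.
    by rewrite (is_leaf_subf (m_subf M _ li)) ei (good_leaf gd L).
  by rewrite (m_lam M) li ei.
- move=> [t [q [/(m_tok M) [v ->] _]]]; rewrite (m_lam M) li ei /= => L'.
  by have := @carries_last_side _ _ _ _ _ (tr pi) (tr (pplus pi)) id v _ _ cr L'; case: (j).
Qed.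

(** [with_part] determines its result up to [slc_eq], so one representative describes it. *)
Lemma with_partE s i b B s0 : (forall t, t \in sS s0 <-> (t \in sS s /\ piece_chooses coh s t i b)) ->
  sG s0 = set_nth B (sG s) i B ->
  (forall t k p, sl s0 t (k, p) =
     (t \in sS s0) && (if k == i then sl s t (i, b :: p) else sl s t (k, p))) ->
  forall s', with_part coh s i b B s' <-> slc_eq s' s0.
Proof.
move=> tok eG ls s'; split=> [[eG' tok' ls']|[eG' [eS' ls']]].
  have eS : sS s' = sS s0 by apply/setP => t; apply/idP/idP => [/tok' H|/tok H]; [apply/tok|apply/tok'].
  split; first by rewrite eG'.
  by split=> // t [k p]; rewrite ls' ls eS.
split; first by rewrite eG'.
  by move=> t; rewrite eS'.
by move=> t k p; rewrite ls' ls eS'.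
Qed.

Lemma erases_with G B0 B1 (pi0 : proof bar (G ++ [:: B0])) (pi1 : proof bar (G ++ [:: B1])) :
  erases (G ++ [:: B0]) (tr pi0) -> erases (G ++ [:: B1]) (tr pi1) ->
  erases (G ++ [:: With B0 B1]) (tr (pwith pi0 pi1)).
Proof.
move=> IH0 IH1 K g s M; set n := size G; set i := index n K.
have ln : n < size (G ++ [:: With B0 B1]) by rewrite size_cat addn1.
have li : i < size K := m_index M ln.
have ei : nth 0 K i = n := m_nth_index M ln.
have cr0 := carries_withl pi0 pi1; have cr1 := carries_withr pi0 pi1.
have gd := tr_good (pwith pi0 pi1).
have gd0 := tr_good pi0; have gd1 := tr_good pi1.
pose S0 := [set g (inl u) | u : ltok (tr pi0)].
pose S1 := [set g (inr u) | u : ltok (tr pi1)].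
pose part b (B : form A) (S : {set T}) : slc A T := Slc (set_nth B (sG s) i B) S
  (fun t x => (t \in S) && (if x.1 == i then sl s t (i, b :: x.2) else sl s t x)).
pose s0 := part false B0 S0; pose s1 := part true B1 S1.
have tok0 t : t \in S0 <-> exists u : ltok (tr pi0), t = g (inl u).
  by split=> [/imsetP[u _ ->]|[u ->]]; [exists u|apply: imset_f].
have tok1 t : t \in S1 <-> exists u : ltok (tr pi1), t = g (inr u).
  by split=> [/imsetP[u _ ->]|[u ->]]; [exists u|apply: imset_f].
have [M0 Sb0] := @matches_last G B0 _ false (tr pi0) (tr (pwith pi0 pi1)) inl K g s s0 M cr0
  erefl tok0 (fun _ _ _ => erefl).
have [M1 Sb1] := @matches_last G B1 _ true (tr pi1) (tr (pwith pi0 pi1)) inr K g s s1 M cr1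
  erefl tok1 (fun _ _ _ => erefl).
have [C0 E0] := IH0 _ _ _ M0; have [C1 E1] := IH1 _ _ _ M1.
have dS : [disjoint S0 & S1].
  rewrite -setI_eq0; apply/eqP/setP => t; rewrite !inE; apply/negbTE/negP => /andP[].
  by move=> /tok0 [u ->] /tok1 [v] /(m_inj M).
have covS t : t \in sS s -> t \in S0 \/ t \in S1.
  by move/(m_tok M) => [[u|u] ->]; [left; apply/tok0|right; apply/tok1]; exists u.
have coh01 t0 t1 : t0 \in S0 -> t1 \in S1 -> coh t0 t1 = false.
  by move=> /tok0 [u ->] /tok1 [v ->]; rewrite (m_coh M).
have Cs : connected coh s.
  have [u0 _] := good_inh gd0; have [u1 _] := good_inh gd1.
  have S0u : g (inl u0) \in S0 by apply/tok0; exists u0.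
  have S1u : g (inr u1) \in S1 by apply/tok1; exists u1.
  apply: (connected_join Sb0 Sb1 C0 C1 (v0 := inl (g (inl u0))) (v1 := inl (g (inr u1)))) => //.
    by move=> k; rewrite (m_size M) (m_size M0) => lk; left; exists k.
  (* Links of different premises conflict, and conflict is an edge. *)
  apply: hconn_edge => /=.
  - by case: Sb0 => + _ _; apply.
  - by case: Sb1 => + _ _; apply.
  - by rewrite (m_conf M).
(* No link of one premise is coherent with a link of the other, so a piece stays within one
   premise. *)
have pc0 t t' : piece_conn coh s t t' -> t \in S0 -> t' \in S0.
  elim=> {t t'} [t t' /and3P[_ St' c] S0t|//|t t' t'' _ H1 _ H2 /H1 /H2 //].
  by case: (covS _ St') => // S1t; rewrite (coh01 _ _ S0t S1t) in c.
have pc1 t t' : piece_conn coh s t t' -> t \in S1 -> t' \in S1.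
  elim=> {t t'} [t t' /and3P[_ St' c] S1t|//|t t' t'' _ H1 _ H2 /H1 /H2 //].
  by case: (covS _ St') => // S0t; rewrite coh_sym (coh01 _ _ S0t S1t) in c.
(* A link equal or coherent to [u] lies in the piece of [u]. *)
have touch u b : (exists u' p, (u' = u \/ lcoh u u') /\ llam u' (n, b :: p)) ->
    piece_touches coh s (g u) i b.
  move=> [u' [p [U L]]]; exists (g u'), p; split.
  - by apply/(m_tok M); exists u'.
  - case: U => [->|c]; first exact: rt_refl.
    apply: rt_step; rewrite (m_coh M) c andbT.
    by apply/andP; split; apply/(m_tok M); [exists u|exists u'].
  - by rewrite (is_leaf_subf (m_subf M _ li)) ei (good_leaf gd L).
  - by rewrite (m_lam M) li ei.
have ch0 t : t \in S0 -> piece_chooses coh s t i false.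
  move=> /[dup] S0t /tok0 [u e]; split; first by rewrite e; apply: touch; exact: touch_last cr0 gd0.
  move=> [t' [p [_ /pc0 /(_ S0t) /tok0 [v ->] _]]]; rewrite (m_lam M) li ei /= => L.
  by have := @carries_last_side _ _ _ _ _ (tr pi0) (tr (pwith pi0 pi1)) inl v true p cr0 L.
have ch1 t : t \in S1 -> piece_chooses coh s t i true.
  move=> /[dup] S1t /tok1 [u e]; split; first by rewrite e; apply: touch; exact: touch_last cr1 gd1.
  move=> [t' [p [_ /pc1 /(_ S1t) /tok1 [v ->] _]]]; rewrite (m_lam M) li ei /= => L.
  by have := @carries_last_side _ _ _ _ _ (tr pi1) (tr (pwith pi0 pi1)) inr v false p cr1 L.
split=> //; apply: (@erasable_binary _ _ _ _ s s0 s1 Cs C1 _ _ dS _ E0 E1).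
- by apply/subsetP; case: Sb0.
- by apply/subsetP; case: Sb1.
right; right; right; exists i, B0, B1; split.
- by rewrite (m_onth M li) ei onth_cat ltnn subnn.
- by move=> t /covS [/ch0|/ch1]; [left|right].
move=> s'.
rewrite (@with_partE s i false B0 s0) // ?(@with_partE s i true B1 s1) //.
- move=> t; split=> [S1t|[/covS [/ch0 [H _] [_ []]|//]]] //.
  by split; [case: Sb1 => + _ _; apply|exact: ch1].
- move=> t; split=> [S0t|[/covS [//|/ch1 [H _] [_ []]]]] //.
  by split; [case: Sb0 => + _ _; apply|exact: ch0].
Qed.

(** Links and kept positions are parameters, so the part can be built before the components of the
    graph are known. *)
Definition tens_slc s i (b : bool) (B : form A) (S : {set T}) (sel : seq nat) : slc A T :=
  Slc (map (fun j => if j == i then B else nth B (sG s) j) sel) S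
      (fun t x => [&& t \in S, x.1 < size sel &
         (let j := nth 0 sel x.1 in
          if j == i then sl s t (i, b :: x.2) else sl s t (j, x.2))]).

(** Serves both premises of a tensor: [P] selects the names going to one side, the tensor itself
    included, and [q] inverts [h] on them. *)
Lemma matches_side G G' (n : nat) B b (P : pred nat) q h c (l' l : lk) (r : ltok l' -> ltok l)
    K (g : ltok l -> T) s (S : {set T}) :
  let i := index n K in
  let sel := [seq j <- iota 0 (size K) | P (nth 0 K j)] in
  n < size G -> matches G K g s -> carries h c G' G r ->
  (forall x, x < size G -> P x ->
     [/\ q x < size G', h (q x) = x, c (q x) = (if x == n then [:: b] else [::]) &
         onth G' (q x) = if x == n then Some B else onth G x]) ->
  (forall y, y < size G' -> [/\ h y < size G, P (h y) & q (h y) = y]) ->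
  (forall t, t \in S <-> exists u, t = g (r u)) ->
  matches G' (map (fun j => q (nth 0 K j)) sel) (g \o r) (tens_slc s i b B S sel) /\
  sub_slc (nth 0 sel) (fun k => if nth 0 sel k == i then [:: b] else [::])
    (tens_slc s i b B S sel) s.
Proof.
move=> i sel ln M cr qP hP ts.
have li : i < size K := m_index M ln.
have selP j : (j \in sel) = (j < size K) && P (nth 0 K j).
  by rewrite mem_filter mem_iota andbC.
have usel : uniq sel by rewrite filter_uniq // iota_uniq.
have qsel j : j \in sel -> [/\ j < size K, q (nth 0 K j) < size G', h (q (nth 0 K j)) = nth 0 K j,
    c (q (nth 0 K j)) = (if j == i then [:: b] else [::]) &
    onth G' (q (nth 0 K j)) = if j == i then Some B else onth (sG s) j].
  rewrite selP => /andP[lj Pj]; have [h1 h2 h3 h4] := qP _ (m_nth_lt M lj) Pj.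
  by rewrite -(m_nth_eq M ln lj) (m_onth M lj).
set K' := map _ sel; have zK' : size K' = size sel by rewrite size_map.
have nK' k : k < size sel -> nth 0 K' k = q (nth 0 K (nth 0 sel k)).
  by move=> lk; rewrite (nth_map 0).
apply: (matches_premise M cr); rewrite ?zK'.
- apply: uniq_perm; rewrite ?iota_uniq //.
    rewrite map_inj_in_uniq // => j j' /qsel [lj _ e _ _] /qsel [lj' _ e' _ _] eq.
    by apply/eqP; rewrite -(nth_uniq 0 lj lj' (m_uniq M)) -e -e' eq.
  move=> y; rewrite mem_iota /= add0n; apply/mapP/idP => [[j /qsel [_ + _ _ _] ->] //|ly].
  have [hy Ph qh] := hP y ly; rewrite -(m_mem M) in hy.
  exists (index (h y) K); last by rewrite nth_index.
  by rewrite selP index_mem hy nth_index.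
- by move=> k lk; rewrite nK' //; have [? ? ? ? ?] := qsel _ (mem_nth 0 lk).
- by rewrite size_map.
- move=> k lk; have [lj _ _ _ e] := qsel _ (mem_nth 0 lk).
  rewrite nK' // e /= onthE -map_comp (nth_map 0) //=; case: eqP => // _.
  by rewrite (onth_lt B) // (m_size M).
- exact: ts.
- by move=> t k p; rewrite /= /place /=; case: eqP => [->|].
Qed.

Lemma tens_partE s i b B (S : {set T}) sel : sorted ltn sel ->
  (forall j, j \in sel <-> (j < size (sG s) /\
     (j = i \/ hconn coh s (del_root s i) (inr (i, [:: b])) (inr (j, [::]))))) ->
  (forall t, t \in S <-> (t \in sS s /\ hconn coh s (del_root s i) (inr (i, [:: b])) (inl t))) ->
  forall s', tens_part coh s i b B s' <-> slc_eq s' (tens_slc s i b B S sel).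
Proof.
move=> srt selP SP s'; split=> [[sel' [srt' selP' eG' tok' ls']]|[eG' [eS' ls']]].
  (* A strictly sorted list is determined by its members. *)
  have esel : sel' = sel.
    apply: (irr_sorted_eq ltn_trans ltnn srt' srt) => j.
    by apply/idP/idP => [/selP' H|/selP H]; [apply/selP|apply/selP'].
  have eS : sS s' = S by apply/setP => t; apply/idP/idP => [/tok' H|/SP H]; [apply/SP|apply/tok'].
  by rewrite esel in eG' ls'; split=> //; split=> // t [k p]; rewrite ls' eS.
exists sel; split=> //.
- by move=> t; rewrite eS' /=; exact: SP.
- by move=> t k p; rewrite ls' eS'.
Qed.

Lemma erases_tens G B C D (pi0 : proof bar (G ++ [:: B])) (pi1 : proof bar (C :: D)) :
  erases (G ++ [:: B]) (tr pi0) -> erases (C :: D) (tr pi1) ->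
  erases (G ++ Tens B C :: D) (tr (ptens pi0 pi1)).
Proof.
move=> IH0 IH1 K g s M; set n := size G; set i := index n K.
have zG : size (G ++ Tens B C :: D) = n + (size D).+1 by rewrite size_cat.
have ln : n < size (G ++ Tens B C :: D) by rewrite zG; lia.
have li : i < size K := m_index M ln.
have ei : nth 0 K i = n := m_nth_index M ln.
have cr0 := carries_tensl pi0 pi1; have cr1 := carries_tensr pi0 (tr_good pi1).
have Gi : onth (sG s) i = Some (Tens B C).
  by rewrite (m_onth M li) ei onth_cat ltnn subnn.
pose F b := if b then C else B.
pose P (b : bool) x := if b then n <= x else x <= n.
pose sel b := [seq j <- iota 0 (size K) | P b (nth 0 K j)].
pose S (b : bool) : {set T} := if b then [set g (inr u) | u : ltok (tr pi1)]
                               else [set g (inl u) | u : ltok (tr pi0)].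
pose sb b := tens_slc s i b (F b) (S b) (sel b).
pose cs b k := if nth 0 (sel b) k == i then [:: b] else [::].
have tok0 t : t \in S false <-> exists u : ltok (tr pi0), t = g (inl u).
  by split=> [/imsetP[u _ ->]|[u ->]]; [exists u|apply: imset_f].
have tok1 t : t \in S true <-> exists u : ltok (tr pi1), t = g (inr u).
  by split=> [/imsetP[u _ ->]|[u ->]]; [exists u|apply: imset_f].
have [M0 Sb0] : matches (l := tr pi0) (G ++ [:: B]) (map (fun j => id (nth 0 K j)) (sel false))
    (g \o inl) (sb false) /\ sub_slc (nth 0 (sel false)) (cs false) (sb false) s.
  apply: (matches_side (B := B) (b := false) (S := S false) (P := P false) (q := id) ln M cr0) => //.
    rewrite zG size_cat addn1 -/n /P => x lx Px; split=> //.
    rewrite !onth_cat -/n; by case: (ltngtP x n) Px => // -> _; rewrite ?ltnn ?subnn.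
  by rewrite zG size_cat addn1 -/n /P => y ly; split=> //; lia.
have [M1 Sb1] : matches (l := tr pi1) (C :: D) (map (fun j => nth 0 K j - n) (sel true))
    (g \o inr) (sb true) /\ sub_slc (nth 0 (sel true)) (cs true) (sb true) s.
  apply: (matches_side (B := C) (b := true) (S := S true) (P := P true) (q := fun x => x - n)
           ln M cr1) => //.
    rewrite zG /P => x lx Px; rewrite /tens_h /tens_c /= subnKC //; split=> //; first lia.
      by rewrite subn_eq0; case: (ltngtP x n) Px.
    rewrite onth_cat -/n; case: (ltngtP x n) Px => // [lnx _|-> _]; last by rewrite subnn.
    by have -> : x - n = (x - n).-1.+1 by lia.
  by rewrite zG /P /tens_h => y ly /=; split; [rewrite /= in ly; lia|lia|rewrite addKn].
have [C0 E0] := IH0 _ _ _ M0; have [C1 E1] := IH1 _ _ _ M1.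
have Sb b : sub_slc (nth 0 (sel b)) (cs b) (sb b) s by case: b.
have Cb b : connected coh (sb b) by case: b.
have selP b j : (j \in sel b) = (j < size K) && P b (nth 0 K j).
  by rewrite mem_filter mem_iota andbC.
have isel b : i \in sel b by rewrite selP li ei /P leqnn; case: b.
have SS b t : t \in S b -> t \in sS s by case: (Sb b) => + _ _; apply.
have covS t : t \in sS s -> t \in S false \/ t \in S true.
  by move/(m_tok M) => [[u|u] ->]; [left; apply/tok0|right; apply/tok1]; exists u.
have dS b t : t \in S b -> t \in S (~~ b) -> False.
  by case: b => [/tok1 [u ->] /tok0 [v]|/tok0 [u ->] /tok1 [v]] /(m_inj M).
have confS b t t' : t \in S b -> t' \in S (~~ b) -> conf coh t t' = false.
  case: b => [/tok1 [u ->] /tok0 [v ->]|/tok0 [u ->] /tok1 [v ->]];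
  by rewrite (m_conf M) /conf andbF.
(* The predicted component of child [b] once the root is deleted; the root itself is on neither
   side. *)
pose side b (v : vtx T) := match v with
  | inl t => t \in S b
  | inr (j, p) => if j == i then (if p is d :: _ then d == b else false) else j \in sel b
  end.
have side_excl b v : side b v -> side (~~ b) v -> False.
  case: v => [t|[j [|d p]]] /=; first exact: dS.
    case: eqP => // ne; rewrite !selP => /andP[lj Pj] /andP[_ Pj'].
    by have /eqP := m_nth_eq M ln lj; case: (b) Pj Pj'; rewrite /P /= => H1 H2; case: eqP => //; lia.
  case: eqP => [_ /eqP -> /eqP|ne]; first by case: b.
  rewrite !selP => /andP[lj Pj] /andP[_ Pj'].
  by have /eqP := m_nth_eq M ln lj; case: (b) Pj Pj'; rewrite /P /= => H1 H2; case: eqP => //; lia.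
have side_cov v : del_root s i v -> side false v \/ side true v.
  case: v => [t|[j p]] /andP[V ne]; first exact: covS.
  have lj := vertex_lt V; rewrite (m_size M) /= in lj.
  rewrite /=; have [e|_] := eqVneq j i; last by rewrite !selP lj /P /=; lia.
  by case: p {V} ne => [|[] p] ne; [rewrite e eqxx in ne|right|left].
have side_sl b t j p : t \in S b -> sl s t (j, p) -> side b (inr (j, p)).
  move=> St L; have lj : j < size K by case: (m_sl M L).
  have [u Lu] : exists2 u, (if b then exists v, u = inr v else exists v, u = inl v) &
      llam (l := tr (ptens pi0 pi1)) u (nth 0 K j, p).
    by case: b St => [/tok1 [v e]|/tok0 [v e]]; move: L; rewrite e (m_lam M) lj /= => L;
       [exists (inr v)|exists (inl v)] => //; exists v.
  rewrite /side -(m_nth_eq M ln lj) selP lj /P; case: b {St} Lu => -[v ->] /=;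
    rewrite ?/back_last -/n.
    by case: ltngtP => //; case: p {L} => // -[].
  by case: ltngtP => //; case: p {L} => // -[].
(* No edge crosses: links of different premises are coherent, a link touches leaves of its own side
   only, and a parse edge that misses the root stays on one side. *)
have side_edge b w w' : side b w -> del_root s i w -> del_root s i w' ->
    hedge coh s w w' -> side b w'.
  move=> sw dw dw' E; have : side b w' \/ side (~~ b) w' by case: b {sw} (side_cov _ dw') => -[]; tauto.
  case=> // sw'; exfalso.
  case: w w' sw dw dw' E sw' => [t|[j p]] [t'|[j' q]].
  - by move=> St _ _ /= + St'; rewrite (confS b).
  - by move=> St _ _ L; exact: (side_excl b _ (side_sl _ _ _ _ St L)).
  - by move=> sj _ _ L St; exact: (side_excl b _ sj (side_sl _ _ _ _ St L)).
  - move=> sj /andP[_ np] /andP[_ nq] /= /andP[/eqP ejj E] sj'; subst j'.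
    apply: (side_excl b _ sj); move: sj sj' np nq; rewrite /=; case: eqP => [->|//].
    by case: p q E => [|d p] [|d' q] //= /or4P[] /eqP [<-] ? // -> ; case: (b).
have head b : del_root s i (inr (i, [:: b])).
  by rewrite /del_root /= /is_vertex /subf_at /= Gi /=; case: b; rewrite subf0; apply/eqP.
(* Each part is connected by induction, and its paths lift to paths that avoid the root. *)
have reach b v : side b v -> hvert s v -> hconn coh s (del_root s i) (inr (i, [:: b])) v.
  have base w : hvert (sb b) w ->
      hconn coh s (del_root s i) (inr (i, [:: b])) (vlift (nth 0 (sel b)) (cs b) w).
    move=> Vw; have Vk : hvert (sb b) (inr (index i (sel b), [::])).
      by rewrite /= root_vertex size_map index_mem.
    have H HP := hconn_lift (P := del_root s i) (Sb b) HP ((Cb b).2 _ _ Vk Vw).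
    have e : vlift (nth 0 (sel b)) (cs b) (inr (index i (sel b), [::])) = inr (i, [:: b]) :> vtx T.
      by rewrite /= /place /cs /= nth_index // eqxx.
    rewrite e in H; apply: H => w' Vw'; rewrite /del_root (hvert_lift (Sb b) Vw') /=.
    case: w' Vw' => // -[k p] _; rewrite /= /place /cs /=.
    have [->|ne] := eqVneq (nth 0 (sel b) k) i; first by apply/eqP.
    by apply/eqP => -[e' _]; rewrite e' eqxx in ne.
  case: v => [t|[j p]] sv V; first exact: (base (inl t) sv).
  move: sv; rewrite /=; case: eqP => [e|ne].
    case: p V => // d p V /eqP ed; subst d j; apply: (hconn_sym coh_sym).
    apply: (@hconn_prefix _ _ _ s _ i [:: b] p) => // r Vr.
    by apply/andP; split=> //; apply/eqP.
  move=> jsel; have Vk : hvert (sb b) (inr (index j (sel b), [::])).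
    by rewrite /= root_vertex size_map index_mem.
  have := base _ Vk; rewrite /= /place /cs /= nth_index //; case: eqP => // _ H.
  apply: (hconn_trans H); apply: (hconn_sym coh_sym).
  apply: (@hconn_prefix _ _ _ s _ j [::] p) => // r Vr; apply/andP; split=> //.
  by apply/eqP => -[].
have hconnE b v : hconn coh s (del_root s i) (inr (i, [:: b])) v -> side b v.
  apply: (hconn_inv (Q := side b)) => [w w' sw dw dw' E|]; first exact: side_edge E.
  by rewrite /= !eqxx.
have Cs : connected coh s.
  have Vk b : hvert (sb b) (inr (index i (sel b), [::])).
    by rewrite /= root_vertex size_map index_mem.
  apply: (connected_join (Sb false) (Sb true) (Cb false) (Cb true) _ _ (Vk false) (Vk true)).
  - exact: covS.
  - move=> k; rewrite (m_size M) => lk; rewrite !size_map.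
    have : k \in sel false \/ k \in sel true by rewrite !selP lk /P /=; lia.
    case=> ks; [left; exists (index k (sel false))|right; exists (index k (sel true))];
      by rewrite ?index_mem ?nth_index.
  (* The two children of the tensor are joined through its root. *)
  - rewrite /= /place /cs /= !nth_index // eqxx.
    have Vi : is_vertex (sG s) (i, [::]) by rewrite root_vertex (m_size M).
    have e b : hconn coh s (hvert s) (inr (i, [:: b] ++ [::])) (inr (i, [::])).
      apply: hconn_edge => //=; first by case/andP: (head b).
      by rewrite eqxx; case: b; rewrite ?orbT.
    apply: (hconn_trans (e false)); apply: (hconn_sym coh_sym); exact: e.
split=> //; apply: (@erasable_binary _ _ _ _ s (sb false) (sb true) Cs C1 _ _ _ _ E0 E1).
- by apply/subsetP; exact: SS.
- by apply/subsetP; exact: SS.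
- rewrite -setI_eq0; apply/eqP/setP => t; rewrite !inE; apply/negbTE/negP => /andP[].
  exact: dS.
left; exists i, B, C; split=> //.
- exists (inr (i, [:: false])), (inr (i, [:: true])); split=> //.
    by move=> /hconnE /=; rewrite eqxx.
  move=> w dw; have Vw : hvert s w by case/andP: dw.
  by case: (side_cov w dw) => sw; [left|right]; exact: reach.
- have part b : forall s', tens_part coh s i b (F b) s' <-> slc_eq s' (sb b).
    apply: tens_partE.
    + by apply: sorted_filter; [exact: ltn_trans|exact: iota_ltn_sorted].
    + move=> j; rewrite (m_size M); split=> [js|[lj]].
        have lj : j < size K by move: js; rewrite selP => /andP[].
        split=> //; have [->|ne] := eqVneq j i; [by left|right].
        apply: reach; first by rewrite /= (negbTE ne).
        by rewrite /= root_vertex (m_size M).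
      by case=> [->//|/hconnE /=]; case: eqP => // ->.
    + by move=> t; split=> [St|[_ /hconnE]] //; split; [exact: SS St|exact: (reach b (inl t) St (SS _ _ St))].
  by move=> s'; rewrite -!part.
Qed.

Lemma tr_erases (bar_invol : involutive bar) G (pi : proof bar G) : erases G (tr pi).
Proof.
elim: pi => {G} [a|G q pq pi|G B C pi|G B0 B1 i pi|G B C D p0 e0 p1 e1|G B0 B1 p0 e0 p1 e1].
- exact: erases_ax.
- exact: erases_perm.
- exact: erases_par.
- exact: erases_plus.
- exact: erases_tens.
- exact: erases_with.
Qed.

End Matching.

(** * Erasable slicings come from proofs *)

(** Reachability and the choice of a side by a piece are propositions; excluded middle turns them
    into sets of tokens. *)
Definition asb (P : Prop) : bool := if excluded_middle_informative P then true else false.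

Lemma asbP (P : Prop) : reflect P (asb P).
Proof. by rewrite /asb; case: excluded_middle_informative; constructor. Qed.

Lemma ord_seq_of_nats m (Q : seq nat) : perm_eq Q (iota 0 m) ->
  exists2 q : seq 'I_m, perm_eq q (enum 'I_m) & map val q = Q.
Proof.
move=> pQ; exists (pmap insub Q).
  apply: (perm_map_inj val_inj); rewrite val_enum_ord.
  rewrite (pmap_filter (@insubK _ _ _)) (_ : filter _ Q = Q) //; apply/all_filterP/allP => k.
  by rewrite (perm_mem pQ) mem_iota /= add0n => lk; rewrite insubT.
rewrite (pmap_filter (@insubK _ _ _)); apply/all_filterP/allP => k.
by rewrite (perm_mem pQ) mem_iota /= add0n => lk; rewrite insubT.
Qed.

Section Sequentialize.
Variables (A : eqType) (bar : A -> A) (T : finType) (coh : rel T).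
Hypothesis coh_sym : symmetric coh.
Hypothesis coh_irr : irreflexive coh.
Implicit Types (s : slc A T) (K : seq nat) (G D : seq (form A)) (S : {set T}).
Implicit Types (F : nat -> form A).

(** [sequentializable] for a subset of the tokens: all slicings of a run share the type [T], so an
    injection with image [S] replaces the bijection. *)
Definition seqz G S (lam : T -> addr -> bool) : Prop :=
  exists (pi : proof bar G) (g : ltok (tr pi) -> T),
  [/\ injective g, (forall t, t \in S <-> exists u, t = g u),
      (forall u v, lcoh u v = coh (g u) (g v)) & forall u x, llam u x = lam (g u) x].

Lemma seqz_ext G S lam lam' : (forall t x, t \in S -> lam t x = lam' t x) ->
  seqz G S lam -> seqz G S lam'.
Proof.
move=> E [pi [g [i t c l]]]; exists pi, g; split=> // u x.
by rewrite l E //; apply/t; exists u.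
Qed.

(* A sequent presented by a list [K] of names of formula occurrences; the order
   of [K] is immaterial by [nseqz_perm]. *)
Definition nlam K (lam : T -> nat -> seq bool -> bool) (t : T) (x : addr) : bool :=
  (x.1 < size K) && lam t (nth 0 K x.1) x.2.

Definition nseqz K F S lam : Prop := seqz (map F K) S (nlam K lam).

Lemma nseqz_perm K' K F S lam : perm_eq K K' -> nseqz K F S lam -> nseqz K' F S lam.
Proof.
rewrite perm_sym => /(perm_iotaP 0) [Q pQ ->].
rewrite -(size_map F K) in pQ; have [q pq eQ] := ord_seq_of_nats pQ.
have ltQ k : k \in Q -> k < size K by rewrite (perm_mem pQ) mem_iota size_map.
move=> [pi [g [ij t c l]]]; rewrite /nseqz.
have -> : map F (map (nth 0 K) Q) = map (tnth (in_tuple (map F K))) q.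
  rewrite (tnth_map_nth q (F 0)) eQ -map_comp.
  by apply/eq_in_map => k /ltQ lk /=; rewrite (nth_map 0).
have zq : size q = size Q by rewrite -eQ (size_map val).
exists (pperm pq pi), g; split=> // u [k p]; rewrite /nlam /= eQ zq (size_map (nth 0 K)).
by case: ltnP => //= lk; rewrite l /nlam /= ltQ ?mem_nth // (nth_map 0).
Qed.

(* [lam'] is [lam] with the formula named [i] turned into the [b]-subformula of a larger one. *)
Definition opens (b : bool) i K S (lam lam' : T -> nat -> seq bool -> bool) : Prop :=
  forall t, t \in S ->
  [/\ forall j p, j \in K -> lam' t j p = lam t j p, lam' t i [::] = false &
      forall d p, lam' t i (d :: p) = (d == b) && lam t i p].

(** The name [i] of the left component is reused for the [Par], and the name [k] disappears. *)
Lemma nseqz_par K i k F F' S lam lam' :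
  nseqz (K ++ [:: i; k]) F S lam ->
  {in K, F =1 F'} -> F' i = Par (F i) (F k) ->
  (forall t, t \in S ->
     [/\ forall j p, j \in K -> lam' t j p = lam t j p, lam' t i [::] = false,
         forall p, lam' t i (false :: p) = lam t i p &
         forall p, lam' t i (true :: p) = lam t k p]) ->
  nseqz (K ++ [:: i]) F' S lam'.
Proof.
rewrite /nseqz !map_cat /= => H /eq_in_map eF -> HL; rewrite -eF.
case: H => pi [g [ij t c l]]; exists (ppar pi), g; split=> // u [k0 p].
have /HL [L1 L2 L3 L4] : g u \in S by apply/t; exists u.
rewrite /= size_map /nlam !size_cat /= nth_cat.
have [lk|lk] := ltnP k0 (size K).
  by rewrite ltn_addr // l /nlam size_cat ltn_addr //= nth_cat lk L1 ?mem_nth.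
have [->|ne] := eqVneq k0 (size K); last by apply/esym/negbTE; lia.
rewrite subnn addn1 ltnSn /=; case: p => [|[] p]; rewrite ?L2 ?L3 ?L4 //.
  by rewrite l /nlam size_cat addn2 /= ltnSn nth_cat ltnNge leqnSn subSnn.
by rewrite l /nlam size_cat addn2 /= ltnW // nth_cat ltnn subnn.
Qed.

(** [K1] names formulas contributed by the other premise of a tensor; it is empty for the additive
    rules. *)
Lemma opens_back_last b i K S lam lam' (l : lk) (u : ltok l) t K1 x :
  opens b i K S lam lam' -> t \in S ->
  (forall y, llam u y = nlam (K ++ [:: i]) lam t y) ->
  (forall j p, j \in K1 -> lam' t j p = false) ->
  optlam u (back_last (size K) (Some b) x) = nlam (K ++ i :: K1) lam' t x.
Proof.
move=> O St lu L4; have [L1 L2 L3] := O t St; case: x => k p.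
rewrite /nlam /back_last size_cat /= nth_cat.
have [lk|lk] := ltnP k (size K).
  by rewrite ltn_addr //= lu /nlam size_cat ltn_addr //= nth_cat lk L1 ?mem_nth.
have [->|ne] := eqVneq k (size K).
  rewrite subnn addnS ltnS leq_addr /=; case: p => [|d p]; rewrite ?L2 // L3.
  by case: eqP => //= _; rewrite lu /nlam size_cat addn1 /= ltnSn nth_cat ltnn subnn.
have -> : k - size K = (k - size K).-1.+1 by lia.
rewrite /=; case: ltnP => //= lk'; rewrite L4 //.
have lk1 : (k - size K).-1 < size K1 by lia.
exact: mem_nth.
Qed.

Lemma nseqz_plus K i j F F' B0 B1 S lam lam' :
  nseqz (K ++ [:: i]) F S lam ->
  {in K, F =1 F'} -> F' i = Plus B0 B1 -> F i = (if j then B1 else B0) ->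
  opens j i K S lam lam' -> nseqz (K ++ [:: i]) F' S lam'.
Proof.
rewrite /nseqz !map_cat /= => H /eq_in_map eF -> eFi O; rewrite -eF eFi in H *.
case: H => pi [g [ij t c l]]; exists (pplus pi), g; split=> // u x.
by rewrite /= size_map; apply: (opens_back_last _ O) => //; apply/t; exists u.
Qed.

Lemma nseqz_with K i F0 F1 F' S0 S1 S lam0 lam1 lam' :
  nseqz (K ++ [:: i]) F0 S0 lam0 -> nseqz (K ++ [:: i]) F1 S1 lam1 ->
  {in K, F0 =1 F'} -> {in K, F1 =1 F'} -> F' i = With (F0 i) (F1 i) ->
  opens false i K S0 lam0 lam' -> opens true i K S1 lam1 lam' ->
  (forall t0 t1, t0 \in S0 -> t1 \in S1 -> t0 != t1 /\ coh t0 t1 = false) ->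
  (forall t, t \in S <-> t \in S0 \/ t \in S1) ->
  nseqz (K ++ [:: i]) F' S lam'.
Proof.
rewrite /nseqz !map_cat /= => H0 H1 /eq_in_map eF0 /eq_in_map eF1 -> O0 O1 cr eS.
rewrite -eF0 in eF1 *; rewrite eF1 in H1.
case: H0 => pi0 [g0 [ij0 t0 c0 l0]]; case: H1 => pi1 [g1 [ij1 t1 c1 l1]].
have m0 u : g0 u \in S0 by apply/t0; exists u.
have m1 u : g1 u \in S1 by apply/t1; exists u.
exists (pwith pi0 pi1), (fun u => match u with inl v => g0 v | inr v => g1 v end); split.
- case=> u [] v; [move/ij0 => -> //|move=> e|move=> e|move/ij1 => -> //].
    by have [] := cr _ _ (m0 u) (m1 v); rewrite e eqxx.
  by have [] := cr _ _ (m0 v) (m1 u); rewrite e eqxx.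
- move=> t; split=> [/eS [/t0 [u ->]|/t1 [u ->]]|[[u|u] ->]].
  + by exists (inl u).
  + by exists (inr u).
  + by apply/eS; left.
  + by apply/eS; right.
- case=> u [] v //=; first by rewrite (cr _ _ (m0 u) (m1 v)).2.
  by rewrite coh_sym (cr _ _ (m0 v) (m1 u)).2.
- by case=> u x /=; rewrite size_map; [apply: (opens_back_last _ O0)|apply: (opens_back_last _ O1)].
Qed.

Lemma nseqz_tens K0 K1 i F0 F1 F' S0 S1 S lam0 lam1 lam' :
  nseqz (K0 ++ [:: i]) F0 S0 lam0 -> nseqz (i :: K1) F1 S1 lam1 ->
  {in K0, F0 =1 F'} -> {in K1, F1 =1 F'} -> F' i = Tens (F0 i) (F1 i) ->
  opens false i K0 S0 lam0 lam' -> opens true i K1 S1 lam1 lam' ->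
  (forall t j p, t \in S0 -> j \in K1 -> lam' t j p = false) ->
  (forall t j p, t \in S1 -> j \in K0 -> lam' t j p = false) ->
  (forall t0 t1, t0 \in S0 -> t1 \in S1 -> t0 != t1 /\ coh t0 t1) ->
  (forall t, t \in S <-> t \in S0 \/ t \in S1) ->
  nseqz (K0 ++ i :: K1) F' S lam'.
Proof.
rewrite /nseqz !map_cat /= => H0 H1 /eq_in_map eF0 /eq_in_map eF1 -> O0 O1 f0 f1 cr eS.
rewrite -eF0 -eF1.
case: H0 => pi0 [g0 [ij0 t0 c0 l0]]; case: H1 => pi1 [g1 [ij1 t1 c1 l1]].
have m0 u : g0 u \in S0 by apply/t0; exists u.
have m1 u : g1 u \in S1 by apply/t1; exists u.
exists (ptens pi0 pi1), (fun u => match u with inl v => g0 v | inr v => g1 v end); split.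
- case=> u [] v; [move/ij0 => -> //|move=> e|move=> e|move/ij1 => -> //].
    by have [] := cr _ _ (m0 u) (m1 v); rewrite e eqxx.
  by have [] := cr _ _ (m0 v) (m1 u); rewrite e eqxx.
- move=> t; split=> [/eS [/t0 [u ->]|/t1 [u ->]]|[[u|u] ->]].
  + by exists (inl u).
  + by exists (inr u).
  + by apply/eS; left.
  + by apply/eS; right.
- case=> u [] v //=; first by rewrite (cr _ _ (m0 u) (m1 v)).2.
  by rewrite coh_sym (cr _ _ (m0 v) (m1 u)).2.
- case=> u x /=; rewrite size_map.
    by apply: (opens_back_last _ O0) => // j p; apply: f0.
  have [L1 L2 L3] := O1 _ (m1 u); case: x => k p /=.
  rewrite /nlam size_cat /= nth_cat; case: (ltngtP k (size K0)) => [lk|lk|->].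
  + by rewrite f1 ?andbF // mem_nth.
  + rewrite l1 /nlam /=; have -> : (k - size K0 < (size K1).+1) = (k < size K0 + (size K1).+1) by lia.
    have -> /= : k - size K0 = (k - size K0).-1.+1 by lia.
    case: ltnP => //= lk'; rewrite L1 //.
    have lk1 : (k - size K0).-1 < size K1 by lia.
    exact: mem_nth.
  + rewrite subnn addnS ltnS leq_addr /=; by case: p => [|[] p]; rewrite ?L2 ?L3 ?l1.
Qed.

(** The field [sl] is an arbitrary relation, while a translation relates links to leaves only.
    Excluding stray pairs lets the two agree at every address. *)
Definition wf s : Prop := forall t x, sl s t x -> t \in sS s /\ is_leaf (sG s) x.

Definition slc_seqz s : Prop := seqz (sG s) (sS s) (sl s).

Lemma slc_seqz_eq s s' : slc_eq s s' -> slc_seqz s -> slc_seqz s'.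
Proof.
by move=> [eG [eS el]]; rewrite /slc_seqz eG eS; apply: seqz_ext => t x _; rewrite el.
Qed.

Lemma wf_eq s s' : slc_eq s s' -> wf s -> wf s'.
Proof. by move=> [eG [eS el]] w t x; rewrite -el => /w; rewrite eS eG. Qed.

Lemma wf_sub h c s' s : wf s ->
  (forall k p, k < size (sG s') -> subf_at (sG s) (place h c (k, p)) = subf_at (sG s') (k, p)) ->
  (forall t x, sl s' t x -> [/\ t \in sS s', x.1 < size (sG s') & sl s t (place h c x)]) ->
  wf s'.
Proof.
move=> w Sf L t [k p] /L [St lk /w [_]].
by rewrite (is_leaf_subf (Sf _ _ lk)).
Qed.

Lemma nseqz_slc d s : wf s ->
  nseqz (iota 0 (size (sG s))) (nth d (sG s)) (sS s) (fun t j p => sl s t (j, p)) <-> slc_seqz s.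
Proof.
move=> w; rewrite /nseqz /slc_seqz map_nth_iota0 // take_size.
have E t x : nlam (iota 0 (size (sG s))) (fun t j p => sl s t (j, p)) t x = sl s t x.
  rewrite /nlam size_iota; case: ltnP => [lx|gx] /=; first by rewrite nth_iota // add0n; case: x {lx}.
  apply/esym/negP => /w [_ /is_leaf_lt]; lia.
by split; apply: seqz_ext => t x _; rewrite E.
Qed.

(** Brings position [i] to the end, where the unary and with rules act. *)
Lemma perm_split i m : i < m ->
  perm_eq ((take i (iota 0 m) ++ drop i.+1 (iota 0 m)) ++ [:: i]) (iota 0 m).
Proof.
move=> li; have e : take i (iota 0 m) ++ i :: drop i.+1 (iota 0 m) = iota 0 m.
  have ei : nth 0 (iota 0 m) i = i by rewrite nth_iota.
  by rewrite -{2}ei -drop_nth ?size_iota // cat_take_drop.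
by rewrite -{3}e -[X in perm_eq _ X]cat_rcons -cats1; apply/permPl; exact: perm_catAC.
Qed.

Lemma mem_split i m j : i < m ->
  j \in take i (iota 0 m) ++ drop i.+1 (iota 0 m) -> j < m /\ j != i.
Proof.
move=> li js; have p := perm_split li; split.
  have : j \in iota 0 m by rewrite -(perm_mem p) mem_cat js.
  by rewrite mem_iota.
have : uniq ((take i (iota 0 m) ++ drop i.+1 (iota 0 m)) ++ [:: i]).
  by rewrite (perm_uniq p) iota_uniq.
by rewrite cats1 rcons_uniq => /andP[+ _]; apply: contraNneq => e; rewrite -{1}e.
Qed.

(** * Undoing one erasure step *)

Lemma par_res_wf s i B C : wf s -> onth (sG s) i = Some (Par B C) -> wf (par_res s i B C).
Proof.
move=> w Gi; have li : i < size (sG s) by rewrite -onthTE Gi.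
have zs : size (sG (par_res s i B C)) = (size (sG s)).+1.
  by rewrite /= size_cat /= size_take size_drop li; lia.
apply: (wf_sub (h := fun k => if k <= i then k else k.-1) (c := par_c i) w) => [k p|t [k p]].
  rewrite zs /place /par_c /subf_at /= onth_insert2 // => lk.
  case: (ltngtP k i) => [lki|lki|->]; rewrite ?Gi //.
    by rewrite (ltn_eqF (ltn_trans lki (ltnSn i))).
  by case: eqP => [->|//] /=; rewrite Gi.
rewrite zs /place /par_c /=.
have H x : sl s t x -> t \in sS s /\ x.1 < size (sG s).
  by move=> /w [St /is_leaf_lt].
case: (ltngtP k i) => [lki|lki|->].
- by rewrite (ltn_eqF (ltn_trans lki (ltnSn i))) => /[dup] /H [St lt] L; split=> //; lia.
- case: eqP => [->|ne] /[dup] /H [St /= lt] L; split=> //; lia.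
- by move=> /[dup] /H [St /= lt] L; split=> //; lia.
Qed.

Lemma par_res_seqz s i B C : wf s -> onth (sG s) i = Some (Par B C) ->
  slc_seqz (par_res s i B C) -> slc_seqz s.
Proof.
move=> w Gi; have li : i < size (sG s) by rewrite -onthTE Gi.
set m := size (sG s) in li *; set I := iota 0 m.
have zI : size I = m by rewrite size_iota.
(* Occurrences are named by their positions in [s]; [m], one more than the last of these, is a fresh
   name for the right component. *)
pose K' := take i I ++ [:: i; m] ++ drop i.+1 I.
pose F' j := if j == i then B else if j == m then C else nth B (sG s) j.
pose lam' t j p := if j == i then sl s t (i, false :: p)
  else if j == m then sl s t (i, true :: p) else sl s t (j, p).
have nI k : k < m -> onth I k = Some k by move=> lk; rewrite (onth_lt 0) ?zI // nth_iota.
have oK' k : onth K' k = if k < i then onth I k else if k == i then Some i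
    else if k == i.+1 then Some m else onth I k.-1 by rewrite onth_insert2 ?zI.
have zK' : size K' = m.+1 by rewrite size_cat /= size_take size_drop zI li; lia.
have im : (m == i) = false by apply/negbTE; lia.
have eG : map F' K' = sG (par_res s i B C).
  apply: eq_from_onth => k; rewrite onth_map oK' /= onth_insert2 // /F'.
  have [lkm|gkm] := ltnP k m.+1; last first.
    have [-> ->] : (k < i) = false /\ (k == i) = false by split; lia.
    have -> : (k == i.+1) = false by apply/negbTE; lia.
    by rewrite !onth_default ?zI -/m //; lia.
  case: (ltngtP k i) => [lki|lki|_] /=; last by rewrite eqxx.
    rewrite nI /=; last lia.
    rewrite (ltn_eqF lki) (onth_lt B); last by rewrite -/m; lia.
    by have -> : (k == m) = false by apply/negbTE; lia.
  have [_|ne] /= := eqVneq k i.+1; first by rewrite im eqxx.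
  rewrite nI /=; last lia.
  have [-> ->] : (k.-1 == i) = false /\ (k.-1 == m) = false by split; lia.
  by rewrite (onth_lt B) // -/m; lia.
have el t x : sl (par_res s i B C) t x = nlam K' lam' t x.
  case: x => k p; rewrite /nlam zK' /= -odflt_onth oK' /lam'.
  have [lkm|gkm] := ltnP k m.+1; last first.
    have [-> ->] : (k < i) = false /\ (k == i) = false by split; lia.
    have -> : (k == i.+1) = false by apply/negbTE; lia.
    by apply/negP => /w [_ /is_leaf_lt /=]; rewrite -/m; lia.
  case: (ltngtP k i) => [lki|lki|_] /=; last by rewrite eqxx.
    rewrite nI /=; last lia.
    rewrite (ltn_eqF lki).
    by have -> : (k == m) = false by apply/negbTE; lia.
  have [_|ne] /= := eqVneq k i.+1; first by rewrite im eqxx.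
  rewrite nI /=; last lia.
  by have [-> ->] : (k.-1 == i) = false /\ (k.-1 == m) = false by split; lia.
rewrite {1}/slc_seqz -eG => /(seqz_ext (fun t x _ => el t x)) H.
apply/(nseqz_slc B w); apply: (nseqz_perm (perm_split li)).
have rP j : j \in take i I ++ drop i.+1 I -> (j == i) = false /\ (j == m) = false.
  by move=> /(mem_split li) [lj ne]; split; [apply/negbTE|lia].
apply: (@nseqz_par _ i m F' _ _ lam').
- apply: nseqz_perm H; rewrite /K' catA; apply/permPl; exact: perm_catAC.
- by move=> j /rP [e1 e2]; rewrite /F' e1 e2.
- by rewrite /F' eqxx im eqxx; exact: onth_nth Gi.
- move=> t St; rewrite /lam' eqxx im eqxx; split=> //.
    by move=> j p /rP [-> ->].
  by apply/negP => /w [_]; rewrite /is_leaf /lit_at /subf_at /= Gi.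
Qed.

Lemma map_set_iota G i B m : m = size G -> i < m ->
  set_nth B G i B = map (fun j => if j == i then B else nth B G j) (iota 0 m).
Proof.
move=> -> li; apply: (@eq_from_nth _ B); rewrite size_set_nth ?size_map ?size_iota; first lia.
move=> k lk; have lk' : k < size G by lia.
by rewrite (nth_map 0) ?size_iota // nth_iota // nth_set_nth /=; case: eqP.
Qed.

Lemma set_subf s s' i b B X : onth (sG s) i = Some X ->
  (forall p, subf X (b :: p) = subf B p) -> sG s' = set_nth B (sG s) i B ->
  forall k p, k < size (sG s') ->
  subf_at (sG s) (place id (last_c i b) (k, p)) = subf_at (sG s') (k, p).
Proof.
move=> Gi HX eG k p _; have li : i < size (sG s) by rewrite -onthTE Gi.
rewrite /subf_at eG /place /last_c /= onth_set_nth //; case: eqP => [->|] //.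
by rewrite Gi HX.
Qed.

Lemma named_set s s' i b B m : wf s -> m = size (sG s) -> i < m ->
  sG s' = set_nth B (sG s) i B ->
  (forall t k p, t \in sS s' -> sl s' t (k, p) = if k == i then sl s t (i, b :: p) else sl s t (k, p)) ->
  slc_seqz s' ->
  nseqz (iota 0 m) (fun j => if j == i then B else nth B (sG s) j) (sS s')
    (fun t j p => if j == i then sl s t (i, b :: p) else sl s t (j, p)).
Proof.
move=> w em li eG el; rewrite /slc_seqz eG (map_set_iota _ em li); apply: seqz_ext => t [k p] St.
rewrite el // /nlam size_iota /=; case: ltnP => [lk|lk] /=; first by rewrite nth_iota.
case: eqP => [e|_]; first lia.
by apply/negP => /w [_ /is_leaf_lt /=]; lia.
Qed.

Lemma opens_set s i b X K S : wf s -> onth (sG s) i = Some X ->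
  (forall a, X <> Lit a) ->
  (forall j, j \in K -> j != i) ->
  (forall t p, t \in S -> sl s t (i, ~~ b :: p) = false) ->
  opens b i K S (fun t j p => if j == i then sl s t (i, b :: p) else sl s t (j, p))
    (fun t j p => sl s t (j, p)).
Proof.
move=> w Gi nX nK nb t St; split=> [j p /nK /negbTE -> //||d p].
  apply/negP => /w [_]; rewrite /is_leaf /lit_at /subf_at /= Gi subf0.
  by case: X nX {Gi} => // a /(_ a).
rewrite eqxx; case: eqP => [-> //|ne /=].
by have -> : d = ~~ b by [case: d b ne {nb} => [] [] //]; rewrite nb.
Qed.

Lemma plus_res_wf s i j B0 B1 : wf s -> onth (sG s) i = Some (Plus B0 B1) ->
  wf (plus_res s i j (if j then B1 else B0)).
Proof.
move=> w Gi; have li : i < size (sG s) by rewrite -onthTE Gi.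
apply: (wf_sub (h := id) (c := last_c i j) w).
  by apply: (set_subf Gi) => // p; case: j.
move=> t [k p] /=; rewrite size_set_nth /place /last_c /=.
case: eqP => [->|_] /[dup] /w [St /is_leaf_lt /= lk] L; split=> //; lia.
Qed.

Lemma plus_res_seqz s i j B0 B1 : wf s -> onth (sG s) i = Some (Plus B0 B1) ->
  ~ touches s i (~~ j) ->
  slc_seqz (plus_res s i j (if j then B1 else B0)) -> slc_seqz s.
Proof.
move=> w Gi nt; set B := if j then B1 else B0.
have li : i < size (sG s) by rewrite -onthTE Gi.
move=> /(@named_set s (plus_res s i j B) i j B _ w erefl li erefl (fun _ _ _ _ => erefl)) H.
apply/(nseqz_slc B w); apply: (nseqz_perm (perm_split li)).
apply: (nseqz_plus (j := j)).
- by apply: nseqz_perm H; rewrite perm_sym; exact: perm_split.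
- by move=> k /(mem_split li) [_ /negbTE ->].
- exact: onth_nth Gi.
- by rewrite /= eqxx.
- apply: (opens_set w Gi) => // [k /(mem_split li) [] //|t p St].
  apply/negP => L; apply: nt; exists t, p; split=> //.
  by case: (w _ _ L).
Qed.

Lemma with_part_wf s i b B0 B1 s' : wf s -> onth (sG s) i = Some (With B0 B1) ->
  with_part coh s i b (if b then B1 else B0) s' -> wf s'.
Proof.
move=> w Gi; have li : i < size (sG s) by rewrite -onthTE Gi.
case: s' => G' S' l' [/= eG tk ls]; subst G'.
apply: (wf_sub (h := id) (c := last_c i b) w).
  by apply: (set_subf Gi) => // p; case: b {tk ls}.
move=> t [k p] /=; rewrite ls size_set_nth /place /last_c /= => /andP[St].
case: eqP => [->|_] /[dup] /w [_ /is_leaf_lt /= lk] L; split=> //; lia.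
Qed.

Lemma with_part_seqz s i B0 B1 : wf s -> onth (sG s) i = Some (With B0 B1) ->
  (forall t, t \in sS s -> piece_chooses coh s t i false \/ piece_chooses coh s t i true) ->
  (forall s', with_part coh s i false B0 s' \/ with_part coh s i true B1 s' -> slc_seqz s') ->
  slc_seqz s.
Proof.
move=> w Gi ch R; have li : i < size (sG s) by rewrite -onthTE Gi.
pose F b := if b then B1 else B0.
pose S b := [set t in sS s | asb (piece_chooses coh s t i b)].
pose part b : slc A T := Slc (set_nth (F b) (sG s) i (F b)) (S b)
  (fun t x => (t \in S b) && (if x.1 == i then sl s t (i, b :: x.2) else sl s t x)).
have SP b t : t \in S b <-> (t \in sS s /\ piece_chooses coh s t i b).
  by rewrite inE; split=> [/andP[-> /asbP]|[-> /asbP]].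
have N b : nseqz (iota 0 (size (sG s))) (fun j => if j == i then F b else nth (F b) (sG s) j)
    (S b) (fun t j p => if j == i then sl s t (i, b :: p) else sl s t (j, p)).
  apply: (@named_set s (part b)) => //=; first by move=> t k p ->.
  by apply: R; case: b; [right|left]; split=> // t; exact: SP.
apply/(nseqz_slc B0 w); apply: (nseqz_perm (perm_split li)).
have N' b := nseqz_perm (etrans (perm_sym _ _) (perm_split li)) (N b).
have O b : opens b i (take i (iota 0 (size (sG s))) ++ drop i.+1 (iota 0 (size (sG s)))) (S b)
    (fun t j p => if j == i then sl s t (i, b :: p) else sl s t (j, p))
    (fun t j p => sl s t (j, p)).
  apply: (opens_set w Gi) => // [k /(mem_split li) [] //|t p /SP [St [_ nt]]].
  apply/negP => L; apply: nt; exists t, p; split=> //; first exact: rt_refl.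
  by case: (w _ _ L).
apply: (nseqz_with (N' false) (N' true) _ _ _ (O false) (O true)).
- move=> k /(mem_split li) [lk /negbTE ->]; exact: set_nth_default.
- move=> k /(mem_split li) [lk /negbTE ->]; exact: set_nth_default.
- by rewrite eqxx; exact: onth_nth Gi.
- move=> t0 t1 /SP [St0 [_ n0]] /SP [St1 [[t2 [p [St2 c lf L]]] n1]].
  (* If [t0] and [t1] shared a piece, the link [t2] on the right side of the root would be in the
     piece of [t0], which chooses the left. *)
  have c01 : piece_conn coh s t0 t1 -> False.
    move=> c01; apply: n0; exists t2, p; split=> //; exact: rt_trans c01 c.
  split; first by apply/eqP => e; apply: c01; rewrite e; exact: rt_refl.
  by apply/negP => e; apply: c01; apply: rt_step; rewrite St0 St1.
- move=> t; split=> [St|[/SP []|/SP []] //].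
  by case: (ch t St) => H; [left|right]; apply/SP.
Qed.

Lemma tens_part_wf s i b B0 B1 s' : wf s -> onth (sG s) i = Some (Tens B0 B1) ->
  tens_part coh s i b (if b then B1 else B0) s' -> wf s'.
Proof.
move=> w Gi [sel [_ selP eG tk ls]].
have zs : size (sG s') = size sel by rewrite eG size_map.
apply: (wf_sub (h := nth 0 sel) (c := fun k => if nth 0 sel k == i then [:: b] else [::]) w).
  move=> k p; rewrite zs => lk; have [lj _] := (selP _).1 (mem_nth 0 lk).
  rewrite /subf_at eG /place /= onth_map (onth_lt 0 lk) /=; case: eqP => [->|_].
    by rewrite Gi; case: b {tk ls eG selP}.
  by rewrite (onth_lt (if b then B1 else B0)).
move=> t [k p]; rewrite ls zs /place /= => /and3P[St lk]; case: eqP => [->|_] L //.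
Qed.

(** On a path from [w] to the root, the vertex before the first visit of the root is one of its two
    children: a tensor is not a leaf, so no link is attached to it. *)
Lemma hconn_child s i B0 B1 w : wf s -> connected coh s ->
  onth (sG s) i = Some (Tens B0 B1) -> del_root s i w ->
  exists b, hconn coh s (del_root s i) (inr (i, [:: b])) w.
Proof.
move=> wfs [_ C] Gi dw; have [Vw nw] := andP dw.
have Vi : hvert s (inr (i, [::])) by rewrite /= root_vertex -onthTE Gi.
pose Q v := (v != inr (i, [::]) /\ hconn coh s (del_root s i) w v) \/
            exists b, hconn coh s (del_root s i) (inr (i, [:: b])) w.
have : Q (inr (i, [::])); last by case=> [[]|//]; rewrite eqxx.
apply: (hconn_inv (Q := Q) _ _ (C w (inr (i, [::])) Vw Vi)); last first.
  by left; split=> //; exact: hconn_refl.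
move=> v v' [[nv H]|H] Vv Vv' E; last by right.
have dv : del_root s i v by rewrite /del_root Vv.
have [e|ne] := eqVneq v' (inr (i, [::])); last first.
  left; split=> //; apply: (hconn_trans H); apply: hconn_edge => //.
  by rewrite /del_root Vv' ne.
right; rewrite e in E; case: v nv H Vv dv E => [t|[j p]] nv H Vv dv E.
  by case: (wfs _ _ E) => _; rewrite /is_leaf /lit_at /subf_at /= Gi.
have [b eb] : exists b, (j, p) = (i, [:: b]).
  case/andP: E => /eqP -> /or4P[] /eqP E.
  - by case: (p) E.
  - by case: (p) E.
  - by exists false; rewrite E.
  - by exists true; rewrite E.
by exists b; rewrite -eb; exact: (hconn_sym coh_sym H).
Qed.

Lemma tens_part_seqz s i B0 B1 : wf s -> connected coh s ->
  onth (sG s) i = Some (Tens B0 B1) -> two_components coh s (del_root s i) ->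
  (forall s', tens_part coh s i false B0 s' \/ tens_part coh s i true B1 s' -> slc_seqz s') ->
  slc_seqz s.
Proof.
move=> w cs Gi [u [v [du dv nuv cov]]] R; have li : i < size (sG s) by rewrite -onthTE Gi.
pose m := size (sG s); pose F b := if b then B1 else B0.
pose C b := hconn coh s (del_root s i) (inr (i, [:: b])).
have exh x : del_root s i x -> C false x \/ C true x.
  by move=> /(hconn_child w cs Gi) [[] H]; [right|left].
(* If the components of the two children met, all vertices would be in one component, against
   [two_components]. *)
have excl x : C false x -> C true x -> False.
  move=> H0 H1; apply: nuv.
  have H01 : C false (inr (i, [:: true])) by apply: (hconn_trans H0); exact: (hconn_sym coh_sym).
  have all y : del_root s i y -> C false y.
    by move=> /exh [//|H]; exact: hconn_trans H01 H.
  by apply: (hconn_trans _ (all v dv)); apply: (hconn_sym coh_sym); exact: all.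
have excl' b x : C b x -> C (~~ b) x -> False by case: b => ? ?; apply: (excl x).
have head b : del_root s i (inr (i, [:: b])).
  by rewrite /del_root /= /is_vertex /subf_at /= Gi /=; case: b; rewrite subf0; apply/eqP.
pose sel b := [seq j <- iota 0 m | (j == i) || asb (C b (inr (j, [::])))].
pose S b := [set t in sS s | asb (C b (inl t))].
have SP b t : t \in S b <-> (t \in sS s /\ C b (inl t)).
  by rewrite inE; split=> [/andP[-> /asbP]|[-> /asbP]].
have selP b j : j \in sel b <-> (j < m /\ (j = i \/ C b (inr (j, [::])))).
  rewrite mem_filter mem_iota /= add0n.
  split=> [/andP[/orP[/eqP H|/asbP H] ->]|[-> [->|/asbP ->]]]; rewrite ?eqxx ?orbT //.
    by split=> //; left.
  by split=> //; right.
have usel b : uniq (sel b) by rewrite filter_uniq // iota_uniq.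
have isel b : i \in sel b by apply/selP; split=> //; left.
pose lamb b t j p := if j == i then sl s t (i, b :: p) else sl s t (j, p).
have N b : nseqz (sel b) (fun j => if j == i then F b else nth (F b) (sG s) j) (S b) (lamb b).
  have : slc_seqz (tens_slc s i b (F b) (S b) (sel b)).
    have P : tens_part coh s i b (F b) (tens_slc s i b (F b) (S b) (sel b)).
      have srt : sorted ltn (sel b).
        by apply: sorted_filter; [exact: ltn_trans|exact: iota_ltn_sorted].
      by apply/(@tens_partE _ _ _ s i b (F b) _ _ srt (selP b) (SP b)); split.
    by apply: R; case: b P; [right|left].
  by apply: seqz_ext => t [k p] St; rewrite /= St.
pose K b := [seq j <- sel b | j != i].
have KP b j : j \in K b -> [/\ j < m, j != i & C b (inr (j, [::]))].
  rewrite mem_filter => /andP[ne /selP [lj [e|H]]]; last by [].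
  by rewrite e eqxx in ne.
have pK b : perm_eq (i :: K b) (sel b).
  apply: uniq_perm; rewrite ?usel //=.
    by rewrite mem_filter eqxx /= filter_uniq.
  by move=> j; rewrite inE mem_filter; case: eqP => [->|] //=; rewrite isel.
have link b t j p : t \in S b -> sl s t (j, p) -> C b (inr (j, p)) \/ (j, p) = (i, [::]).
  move=> /SP [St H] L; have [e|ne] := eqVneq (j, p) (i, [::]); [by right|left].
  apply: (hconn_trans H); apply: hconn_edge => //; apply/andP; split=> //.
  have [_] := w _ _ L; rewrite /= /is_leaf /lit_at /is_vertex.
  by case: subf_at.
have vert t x : sl s t x -> is_vertex (sG s) x.
  by case/w => _; rewrite /is_leaf /lit_at /is_vertex; case: subf_at.
have outK b t j p : t \in S b -> j \in K (~~ b) -> sl s t (j, p) = false.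
  move=> St /KP [lj ne H]; apply/negP => L.
  case: (link _ _ _ _ St L) => [Cj|[e _]]; last by rewrite e eqxx in ne.
  apply: (excl' b (inr (j, [::]))) => //; apply: (hconn_trans Cj).
  apply: (@hconn_prefix _ _ _ s _ j [::] p (vert _ _ L)) => r Vr; apply/andP; split=> //.
  by apply: contra ne => /eqP [->].
have outi b t p : t \in S b -> sl s t (i, ~~ b :: p) = false.
  move=> St; apply/negP => L; case: (link _ _ _ _ St L) => // Cj.
  apply: (excl' b (inr (i, [:: ~~ b]))); last exact: hconn_refl.
  apply: (hconn_trans Cj).
  apply: (@hconn_prefix _ _ _ s _ i [:: ~~ b] p (vert _ _ L)) => r Vr; apply/andP; split=> //.
  by apply/eqP.
have O b : opens b i (K b) (S b) (lamb b) (fun t j p => sl s t (j, p)).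
  by apply: (opens_set w Gi) => // [j /KP [] //|t p]; exact: outi.
apply/(nseqz_slc B0 w).
apply: (@nseqz_perm _ (K false ++ i :: K true)).
  apply: uniq_perm; rewrite ?iota_uniq //.
    have iK b : (i \in K b) = false by rewrite mem_filter eqxx.
    have uK b : uniq (K b) by rewrite filter_uniq // usel.
    rewrite cat_uniq /= !uK !iK /= andbT; apply/hasPn => j /KP [_ _ H1].
    by apply/negP => /KP [_ _ H0]; exact: excl H0 H1.
  move=> j; rewrite mem_cat inE mem_iota /= add0n -/m; apply/idP/idP.
    by case/or3P => [/KP [] //|/eqP -> //|/KP [] //].
  move=> lj; have [->|ne] := eqVneq j i; first by rewrite orbT.
  have dj : del_root s i (inr (j, [::])).
    apply/andP; split; first by rewrite /= root_vertex.
    by apply: contra ne => /eqP [->].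
  have memK b : (j \in K b) = (j \in sel b) by rewrite mem_filter ne.
  rewrite !memK; case: (exh _ dj) => H.
    by have -> : j \in sel false by [apply/selP; split=> //; right].
  by have -> : j \in sel true by [apply/selP; split=> //; right]; rewrite !orbT.
have N0 : nseqz (K false ++ [:: i]) (fun j => if j == i then B0 else nth B0 (sG s) j) (S false) (lamb false).
  by apply: nseqz_perm (N false); rewrite perm_sym cats1 perm_rcons.
have N1 : nseqz (i :: K true) (fun j => if j == i then B1 else nth B1 (sG s) j) (S true) (lamb true).
  by apply: nseqz_perm (N true); rewrite perm_sym.
apply: (nseqz_tens N0 N1 _ _ _ (O false) (O true)).
- by move=> k /KP [lk /negbTE -> _]; exact: set_nth_default.
- by move=> k /KP [lk /negbTE -> _]; exact: set_nth_default.
- by rewrite /= eqxx; exact: onth_nth Gi.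
- by move=> t j p St jK; apply: (outK false).
- by move=> t j p St jK; apply: (outK true).
- move=> t0 t1 /SP [St0 H0] /SP [St1 H1].
  have ne : t0 != t1 by apply/eqP => e; rewrite e in H0; exact: excl H0 H1.
  (* Distinct links that are not coherent conflict, and this edge avoids the root. *)
  split=> //; apply: contraT => nc; exfalso; apply: (excl (inl t1)) => //.
  by apply: (hconn_trans H0); apply: hconn_edge; rewrite /= ?/del_root /= ?St0 ?St1 // /conf ne nc.
- move=> t; split=> [St|[/SP []|/SP []] //].
  have dt : del_root s i (inl t) by rewrite /del_root /= St.
  by case: (exh _ dt) => H; [left|right]; apply/SP.
Qed.

Lemma ready_wf s R s' : wf s -> ready_erase coh s R -> R s' -> wf s'.
Proof.
move=> w [[i [B0 [B1 [Gi _ RE]]]]|[[i [B0 [B1 [Gi RE]]]]|[[i [B0 [B1 [j [Gi _ _ RE]]]]]|[i [B0 [B1 [Gi _ RE]]]]]]] /RE.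
- by case; [exact: (@tens_part_wf s i false B0 B1)|exact: (@tens_part_wf s i true B0 B1)].
- by move=> /slc_eq_sym e; apply: (wf_eq e); exact: par_res_wf.
- by move=> /slc_eq_sym e; apply: (wf_eq e); exact: plus_res_wf.
- by case; [exact: (@with_part_wf s i false B0 B1)|exact: (@with_part_wf s i true B0 B1)].
Qed.

Lemma ready_seqz s R : wf s -> connected coh s -> ready_erase coh s R ->
  (forall s', R s' -> slc_seqz s') -> slc_seqz s.
Proof.
move=> w cs [[i [B0 [B1 [Gi tc RE]]]]|[[i [B0 [B1 [Gi RE]]]]|[[i [B0 [B1 [j [Gi _ nt RE]]]]]|[i [B0 [B1 [Gi ch RE]]]]]]] Rs.
- by apply: (tens_part_seqz w cs Gi tc) => s' /RE; exact: Rs.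
- by apply: (par_res_seqz w Gi); apply: Rs; apply/RE; split=> //; split.
- by apply: (plus_res_seqz w Gi nt); apply: Rs; apply/RE; split=> //; split.
- by apply: (with_part_seqz w Gi ch) => s' /RE; exact: Rs.
Qed.

Lemma single_link_seqz s : single_link bar s -> slc_seqz s.
Proof.
case: s => G S l [a [t [/= -> -> el]]]; exists (pax bar a), (fun=> t); split=> //.
- by case=> [] [].
- by move=> t'; rewrite inE; split=> [/eqP ->|[u ->] //]; exists tt.
- by move=> u x; rewrite /= el eqxx.
Qed.

(** A single induction along the run carries well-formedness forwards and sequentializability
    backwards. *)
Lemma esteps_seqz Y : esteps bar coh (Some Y) (Some (fun=> False)) ->
  (forall s, Y s -> wf s) -> forall s, Y s -> slc_seqz s.
Proof.
move=> E; have {E} H := clos_rt_rt1n _ _ _ _ E.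
(* The error symbol has no successor, so a run ending in the empty cluster never meets it and [Phi]
   may be false there. *)
pose Phi (c : cluster A T) := if c is Some Z then
  (forall s, Z s -> wf s) -> forall s, Z s -> slc_seqz s else False.
rewrite -/(Phi (Some Y)); move: H; set c' := Some (fun=> False); set c := Some Y.
move=> H; have : c' = Some (fun=> False) by [].
elim: H => {c c' Y} [c ->//|c c1 c2 st _ IH e2]; move: st (IH e2) => {IH e2 c2} st.
case: st => {c c1} [Y s _ _ //|Y Y' X R s eY _ cs re _ eY' IH W|Y X s eY _ sg _ IH W].
- have Ws : wf s by apply: W; apply/eY; right; split=> //; split.
  have {}IH s' : Y' s' -> slc_seqz s'.
    apply: IH => {}s' /eY' [Xs|Rs]; first by apply: W; apply/eY; left.
    exact: ready_wf Ws re Rs.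
  move=> s' /eY [Xs|/slc_eq_sym e]; first by apply: IH; apply/eY'; left.
  apply: (slc_seqz_eq e); apply: (ready_seqz Ws cs re) => s1 Rs.
  by apply: IH; apply/eY'; right.
- move=> s' /eY [Xs|/slc_eq_sym e].
    by apply: IH Xs => s1 Xs; apply: W; apply/eY; left.
  by apply: (slc_seqz_eq e); exact: single_link_seqz.
Qed.

End Sequentialize.

Theorem mainTheorem10 (A : eqType) (bar : A -> A)
  (bar_invol : involutive bar) (bar_nofix : forall a, bar a != a)
  (G : seq (form A)) (T : finType) (coh : rel T) (lam : T -> addr -> bool) :
  linking bar G coh lam ->
  (conflict_net bar G coh lam <-> sequentializable bar G coh lam).
Proof.
move=> L; have [[coh_sym coh_irr] [LL _]] := L; split=> [[_ E]|[pi [f [[f' fK f'K] [fc fl]]]]].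
  have W s : slc_eq s (Slc G setT lam) -> wf s.
    move=> /slc_eq_sym e; apply: (wf_eq e) => t x /= Lx; split; first by rewrite inE.
    have [y [z [_ ly lz [_ _ _ H]]]] := LL t.
    by case: (H _ Lx) => ->.
  have [//|pi [g [ij tk gc gl]]] := esteps_seqz coh_sym coh_irr E W (s := Slc G setT lam).
  (* The initial slicing has all tokens as links, so [g] is onto; its inverse is the isomorphism. *)
  have gi t : exists u, g u == t.
    by have /tk [u ->] : t \in sS (Slc G setT lam) by [rewrite inE]; exists u.
  exists pi, (fun t => xchoose (gi t)); split; last split.
  - by exists g => [t|u]; [|apply: ij]; exact/eqP/(xchooseP (gi _)).
  - by move=> t t'; rewrite gc !(eqP (xchooseP (gi _))).
  - by move=> t x; rewrite gl (eqP (xchooseP (gi _))).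
have gd := tr_good pi; split; last first.
  (* The slicing is the copy of the translation with its formulas in their own order; it is then
     erased in the empty context. *)
  have M : matches coh G (iota 0 (size G)) f' (Slc G setT lam).
    split=> //=.
    - by rewrite size_iota.
    - by move=> k; rewrite size_iota => lk; rewrite nth_iota.
    - exact: can_inj f'K.
    - by move=> t; rewrite inE; split=> // _; exists (f t); rewrite fK.
    - by move=> u v; rewrite -fc !f'K.
    - move=> u k p; rewrite -fl f'K size_iota; case: ltnP => [lk|lk]; first by rewrite nth_iota.
      by apply/negP => /(good_leaf gd) /is_leaf_lt /=; lia.
  have [_ er] := tr_erases coh_sym bar_invol M.
  by apply: er => // s'; split=> [|[]] //; right.
have cf t t' : conf coh t t' = conf (@lcoh (tr pi)) (f t) (f t').
  by rewrite /conf fc (can_eq fK).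
split=> //; split; last split.
- move=> [a [b [c [d [U P N]]]]]; case: (good_contr gd); exists (f a), (f b), (f c), (f d).
  by rewrite -!cf; split=> //; rewrite -(map_inj_uniq (can_inj fK)) in U.
- split=> [t x|t t' x y]; first by rewrite -fl; exact: (good_leaf gd).
  by rewrite -!fl cf -fc; exact: (good_map gd).2.
(* Maximality is carried over along the bijection of links. *)
- move=> R [R1 R2] ext t x Rt; rewrite -fl.
  apply: (good_max gd (R := fun u => R (f' u))); last by rewrite fK.
    split=> [u y|u u' y y' Ru Ru']; first exact: R1.
    by have := R2 _ _ _ _ Ru Ru'; rewrite cf -fc !f'K.
  by move=> u y; rewrite -{1}(f'K u) fl; exact: ext.
Qed.
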